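(* Let $f(x)=\mathbb{E}_{\xi\sim\mathcal{D}}[f_\xi(x)]$ on $\mathbb{R}^d$, let $f$ be twice differentiable, and suppose that Assumptions (A1) (unbiased, variance-bounded stochastic gradients and Hessians, with constants $\sigma_g,\sigma_H$), (A2) (lower boundedness), (A3) (symmetric $(L_0,L_1)$-Lipschitz gradient with respect to $\|\cdot\|$, $L_1>0$) and (A4) (symmetric $(M_0,M_1)$-Lipschitz Hessian with respect to $\|\cdot\|$, $M_1>0$), all stated in the context, hold. Let $K\ge 1$ be an integer, and let $\{x_k\}$ be the iterates generated, for $k=0,1,\ldots,K$, from initial points $x_0,m_0\in\mathbb{R}^d$ by the LMO-based method with extrapolated momentum $$x_{k+1}=x_k+\mathrm{lmo}_k(m_k),\qquad \mathrm{lmo}_k(m_k)\in\operatorname*{arg\,min}_{\|x\|\le\eta_k}\langle m_k,x\rangle,$$ $$y_{k+1}=x_{k+1}+\frac{1-\alpha_k}{\alpha_k}(x_{k+1}-x_k),\qquad m_{k+1}=(1-\alpha_k)m_k+\alpha_k\nabla f_{\xi_{k+1}}(y_{k+1}),\qquad \xi_{k+1}\sim\mathcal{D},$$ with $$\alpha_k=\alpha=\frac{1}{(K+1)^{4/7}},\qquad \eta_k=\eta=\frac{\hat\eta}{(K+1)^{5/7}},\qquad \hat\eta=\min\left\{\frac{1}{3L_1},\frac{1}{3\sqrt{M_1}}\right\}.$$ Then, with $e_0:=m_0-\nabla f(x_0)$, $$\min_{k\in\{0,1,\ldots,K\}}\mathbb{E}\bigl[\|\nabla f(x_k)\|_\star\bigr]\le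 \frac{2(f(x_0)-f_{\inf})}{\hat\eta(K+1)^{2/7}}+\frac{\hat\eta L_0\exp(L_1\hat\eta)}{(K+1)^{5/7}}+\frac{4\bigl(\mathbb{E}[\|e_0\|_\star]+\bar\rho\sigma_g\bigr)}{(K+1)^{2/7}}$$ $$\qquad+2\left(M_0+\frac{2M_1}{3}L_0\hat\eta\exp(L_1\hat\eta)\right)\frac{\hat\eta^2}{(K+1)^{2/7}}.$$
   Context: $\|\cdot\|$ is an arbitrary norm on $\mathbb{R}^d$, $\|\cdot\|_\star$ its dual norm ($\|u\|_\star=\max_{\|v\|\le 1}\langle u,v\rangle$), $\|\cdot\|_2$ the Euclidean norm and $\langle\cdot,\cdot\rangle$ the standard inner product. The positive constants $\underline\rho,\bar\rho$ satisfy, for all $x\in\mathbb{R}^d$, $\underline\rho\|x\|_2\le\|x\|_\star\le\bar\rho\|x\|_2$. For a matrix $A\in\mathbb{R}^{d\times d}$, $\|A\|_{\mathrm{op}}:=\sup_{u\ne0}\|Au\|_\star/\|u\|$. $\xi$ is a random vector with distribution $\mathcal{D}$; each $f_\xi:\mathbb{R}^d\to\mathbb{R}$ is differentiable and possibly nonconvex; $\nabla f_\xi(x)$ and $\nabla^2 f_\xi(x)$ are the stochastic gradient and stochastic Hessian. (A1) For all $x,w\in\mathbb{R}^d$: $\mathbb{E}_\xi[\nabla f_\xi(x)]=\nabla f(x)$, $\mathbb{E}_\xi[\|\nabla f_\xi(x)-\nabla f(x)\|_2^2]\le\sigma_g^2$, $\mathbb{E}_\xi[\nabla^2 f_\xi(x)]=\nabla^2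 f(x)$, and $\mathbb{E}_\xi[\|(\nabla^2 f_\xi(x)-\nabla^2 f(x))w\|_2^2]\le\sigma_H^2\|w\|_2^2$. (A2) $f_{\inf}:=\inf_{x\in\mathbb{R}^d}f(x)>-\infty$. (A3) $f$ is differentiable and, for all $x,y\in\mathbb{R}^d$, $\|\nabla f(x)-\nabla f(y)\|_\star\le\bigl(L_0+L_1\sup_{\theta\in[0,1]}\|\nabla f(\theta x+(1-\theta)y)\|_\star\bigr)\|x-y\|$. (A4) $f$ is twice differentiable and, for all $x,y\in\mathbb{R}^d$, $\|\nabla^2 f(x)-\nabla^2 f(y)\|_{\mathrm{op}}\le\bigl(M_0+M_1\sup_{\theta\in[0,1]}\|\nabla f(\theta x+(1-\theta)y)\|_\star\bigr)\|x-y\|$. The samples $\xi_1,\xi_2,\ldots$ are independent with law $\mathcal{D}$; if $m_0$ is random it is independent of them. $\mathbb{E}$ is expectation over all randomness. When the linear minimization problem has several minimizers, $\mathrm{lmo}_k$ is any (measurable) selection. *)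

(* Defs.v *)
From HB Require Import structures.
From mathcomp Require Import all_boot all_order all_algebra finmap.
From mathcomp Require Import all_classical all_reals all_analysis.

Set Implicit Arguments.
Unset Strict Implicit.
Unset Printing Implicit Defensive.

Import Order.TTheory GRing.Theory Num.Theory.
Import numFieldNormedType.Exports.

Local Open Scope classical_set_scope.
Local Open Scope ring_scope.

(* Vectors of R^d are row vectors, so a matrix A acts on a vector u as
   u *m A. *)

Definition dot (R : realType) (d : nat) (u v : 'rV[R]_d) : R :=
  \sum_(i < d) u 0 i * v 0 i.

Definition norm2 (R : realType) (d : nat) (u : 'rV[R]_d) : R :=
  Num.sqrt (dot u u).

Definition is_norm (R : realType) (d : nat) (N : 'rV[R]_d -> R) : Prop :=
  [/\ forall u v, N (u + v) <= N u + N v,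
      forall (a : R) u, N (a *: u) = `|a| * N u &
      forall u, N u = 0 -> u = 0].

(* When N is a norm, the set is nonempty and bounded and its supremum is
   attained, by compactness of the unit ball. *)
Definition dual_norm (R : realType) (d : nat) (N : 'rV[R]_d -> R)
    (u : 'rV[R]_d) : R :=
  sup [set dot u v | v in [set v | N v <= 1]].

(* A genuine supremum (nonempty, bounded set) as soon as 0 < d. *)
Definition op_norm (R : realType) (d : nat) (N : 'rV[R]_d -> R)
    (A : 'M[R]_d) : R :=
  sup [set dual_norm N (u *m A) / N u | u in [set u | u != 0]].

(* The coordinates of the Frechet differential in the canonical basis. *)
Definition grad (R : realType) (d : nat) (f : 'rV[R]_d -> R)
    (x : 'rV[R]_d) : 'rV[R]_d :=
  \row_(i < d) 'd f x (delta_mx 0 i).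

(* The jacobian of the library is the matrix of the differential acting on row
   vectors, i.e. w *m hess f x = 'd (grad f) x w. *)
Definition hess (R : realType) (d : nat) (f : 'rV[R]_d -> R)
    (x : 'rV[R]_d) : 'M[R]_d :=
  jacobian (grad f) x.

Definition twice_differentiable (R : realType) (d : nat)
    (f : 'rV[R]_d -> R) : Prop :=
  (forall x, differentiable f x) /\ (forall x, differentiable (grad f) x).

Definition borel_rV (R : realType) (d : nat) :=
  g_sigma_algebraType (@open 'rV[R]_d).

Definition measurable_rV (R : realType) (d : nat) (disp : measure_display)
    (T : measurableType disp) (X : T -> 'rV[R]_d) : Prop :=
  measurable_fun setT (X : T -> borel_rV R d).

Definition mutually_independent (R : realType) (disp : measure_display)
    (T : measurableType disp) (P : probability T R) (I : choiceType)
    (G : I -> set (set T)) : Prop :=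
  forall (J : {fset I}) (A : I -> set T),
    (forall i, i \in J -> G i (A i)) ->
    P (\bigcap_(i in [set` J]) A i) = (\prod_(i <- J) P (A i))%E.

(* The sigma-algebras generated by m0 (index None) and by xi_1, xi_2, ...
   (index Some k for xi_(k+1)). *)
Definition initial_and_sample_events (R : realType) (d : nat)
    (d1 d2 : measure_display) (S : measurableType d1) (T : measurableType d2)
    (m0 : T -> 'rV[R]_d) (xi : nat -> T -> S) (o : option nat) : set (set T) :=
  if o is Some k then preimage_set_system setT (xi k.+1) measurable
  else preimage_set_system setT (m0 : T -> borel_rV R d) measurable.

Definition is_stochastic_model (R : realType) (d : nat)
    (disp : measure_display) (S : measurableType disp) (D : probability S R)
    (F : S -> 'rV[R]_d -> R) (f : 'rV[R]_d -> R) : Prop :=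
  (forall s, twice_differentiable (F s)) /\
  (forall x, D.-integrable setT (fun s => (F s x)%:E) /\
     ('E_D[fun s => F s x] = (f x)%:E)%E).

Definition unbiased_bounded_variance (R : realType) (d : nat)
    (disp : measure_display) (S : measurableType disp) (D : probability S R)
    (F : S -> 'rV[R]_d -> R) (f : 'rV[R]_d -> R) (sigma_g sigma_H : R) : Prop :=
  [/\ forall x (i : 'I_d),
        D.-integrable setT (fun s => (grad (F s) x 0 i)%:E) /\
        ('E_D[fun s => (grad (F s) x 0 i)%R] = (grad f x 0 i)%:E)%E,
      forall x,
        ('E_D[fun s => (norm2 (grad (F s) x - grad f x) ^+ 2)%R]
           <= (sigma_g ^+ 2)%:E)%E,
      forall x (i j : 'I_d),
        D.-integrable setT (fun s => (hess (F s) x i j)%:E) /\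
        ('E_D[fun s => hess (F s) x i j] = (hess f x i j)%:E)%E &
      forall x w,
        ('E_D[fun s => (norm2 (w *m (hess (F s) x - hess f x)) ^+ 2)%R]
           <= (sigma_H ^+ 2 * norm2 w ^+ 2)%:E)%E].

(* [sup] of an unbounded set is 0 by convention; the set is bounded whenever
   grad f is continuous, in particular for twice differentiable f. *)
Definition sup_grad_segment (R : realType) (d : nat) (N : 'rV[R]_d -> R)
    (f : 'rV[R]_d -> R) (x y : 'rV[R]_d) : R :=
  sup [set dual_norm N (grad f (theta *: x + (1 - theta) *: y))
      | theta in `[0, 1]].

Definition symmetric_lipschitz_grad (R : realType) (d : nat)
    (N : 'rV[R]_d -> R) (f : 'rV[R]_d -> R) (L0 L1 : R) : Prop :=
  forall x y, dual_norm N (grad f x - grad f y)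
    <= (L0 + L1 * sup_grad_segment N f x y) * N (x - y).

Definition symmetric_lipschitz_hess (R : realType) (d : nat)
    (N : 'rV[R]_d -> R) (f : 'rV[R]_d -> R) (M0 M1 : R) : Prop :=
  forall x y, op_norm N (hess f x - hess f y)
    <= (M0 + M1 * sup_grad_segment N f x y) * N (x - y).

(* A Borel selection of the minimizers of <m, .> on the N-ball of radius r. *)
Definition is_lmo (R : realType) (d : nat) (N : 'rV[R]_d -> R) (r : R)
    (lmo : 'rV[R]_d -> 'rV[R]_d) : Prop :=
  measurable_rV (lmo : borel_rV R d -> 'rV[R]_d) /\
  (forall m, N (lmo m) <= r /\
     (forall v, N v <= r -> dot m (lmo m) <= dot m v)).

(* y 0 and xi 0 are unconstrained: the extrapolated points and the samples are
   indexed from 1. *)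
Definition lmo_extrapolated_momentum (R : realType) (d : nat)
    (d1 d2 : measure_display) (S : measurableType d1) (T : measurableType d2)
    (F : S -> 'rV[R]_d -> R) (xi : nat -> T -> S)
    (lmo : nat -> 'rV[R]_d -> 'rV[R]_d) (alpha : nat -> R) (K : nat)
    (x0 : 'rV[R]_d) (m0 : T -> 'rV[R]_d) (x y m : nat -> T -> 'rV[R]_d) : Prop :=
  [/\ forall w, x 0%N w = x0,
      forall w, m 0%N w = m0 w &
      forall k w, (k <= K)%N ->
      [/\ x k.+1 w = x k w + lmo k (m k w),
          y k.+1 w
            = x k.+1 w + ((1 - alpha k) / alpha k) *: (x k.+1 w - x k w) &
          m k.+1 w
            = (1 - alpha k) *: m k w
              + alpha k *: grad (F (xi k.+1 w)) (y k.+1 w)]].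

(* Main.v *)
Require Import Defs.
From HB Require Import structures.
From mathcomp Require Import all_boot all_order all_algebra finmap.
From mathcomp Require Import all_classical all_reals all_analysis.
From mathcomp Require Import measurable_realfun.
From mathcomp Require Import ring lra.
Import Order.TTheory GRing.Theory Num.Theory.
Import numFieldNormedType.Exports.
Local Open Scope classical_set_scope.
Local Open Scope ring_scope.

(* Write e_k = m_k - grad f(x_k) and let V_k be the exponential average of the
   sampling noises, V_{k+1} = (1 - alpha) V_k + alpha n_{k+1}. Extrapolation to
   y_{k+1} cancels the Hessian terms in e_{k+1}, so e_k - V_k contracts by
   1 - alpha up to second-order Taylor remainders, which the generalized
   smoothness bounds by gradient norms along the trajectory. Summing with the
   descent inequality f(x_{k+1}) <= f(x_k) - eta |grad f(x_k)| + 2 eta |e_k| + ...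
   and absorbing the gradient norms gives a pointwise bound on
   sum_k |grad f(x_k)| by |e_0|, sum_k |V_k| and constants. Independence of
   xi_{k+1} from the past gives E|V_k|_2^2 <= alpha sigma^2 by Tonelli, without
   any integrability requirement, and the bound is then integrated. Since f is
   bounded below, its gradient is arbitrarily small somewhere, which forces
   L0, M0 >= 0. *)

(** The noise is split off because the two parts of [e_k] need different norms. The triangle
    inequality in the dual norm would give a noise level that does not decay; the gain comes from
    orthogonality, available only for the Euclidean norm and in expectation, and [rho_hi] converts
    at the end. The drift is bounded outcome by outcome. With [q = (K+1)^(1/7)] one has alpha =
    q^-4, eta = eta_hat q^-5 and eta/alpha = eta_hat/q. The exponents balance three terms at order
    q^-2: 1/(eta (K+1)) from the descent, sqrt(alpha) from the noise and (eta/alpha)^2 from the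
    Taylor remainders. The initial error, 1/(alpha (K+1)) = q^-3, and the quadratic descent term,
    q^-5, are smaller. The factors 3 in eta_hat give L1 eta_hat <= 1/3 and M1 eta_hat^2 <= 1/9, so
    that the absorbed gradient norms cost less than half of their sum. Assumption (A3) bounds an
    increment of the gradient by a supremum of the gradient itself; a Gronwall argument for L0 + L1
    |grad f| turns this into an explicit exponential bound. *)

Set Implicit Arguments.
Unset Strict Implicit.

(** * Dual norms *)

Section DotProduct.
Context {R : realType} {d : nat}.
Implicit Types u v w : 'rV[R]_d.

Lemma dotDl u v w : dot (u + v) w = dot u w + dot v w.
Proof. by rewrite /dot -big_split /=; apply: eq_bigr => i _; rewrite !mxE mulrDl. Qed.

Lemma dotZl a u v : dot (a *: u) v = a * dot u v.
Proof. by rewrite /dot big_distrr /=; apply: eq_bigr => i _; rewrite !mxE mulrA. Qed.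

Lemma dotC u v : dot u v = dot v u.
Proof. by apply: eq_bigr => i _; rewrite mulrC. Qed.

Lemma dotDr u v w : dot w (u + v) = dot w u + dot w v.
Proof. by rewrite dotC dotDl !(dotC w). Qed.

Lemma dotZr a u v : dot u (a *: v) = a * dot u v.
Proof. by rewrite dotC dotZl dotC. Qed.

Lemma dotNl u v : dot (- u) v = - dot u v.
Proof. by rewrite -scaleN1r dotZl mulN1r. Qed.

Lemma dotNr u v : dot u (- v) = - dot u v.
Proof. by rewrite -scaleN1r dotZr mulN1r. Qed.

Lemma dot0l v : dot 0 v = 0.
Proof. by rewrite -(scale0r v) dotZl mul0r. Qed.

Lemma dotxx_ge0 u : 0 <= dot u u.
Proof. by apply: sumr_ge0 => i _; rewrite -expr2 sqr_ge0. Qed.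

Lemma sqr_norm2 u : norm2 u ^+ 2 = dot u u.
Proof. by rewrite sqr_sqrtr// dotxx_ge0. Qed.

Lemma norm2_ge0 u : 0 <= norm2 u.
Proof. exact: sqrtr_ge0. Qed.

Lemma norm2_eq0 u : norm2 u = 0 -> u = 0.
Proof.
move=> u0; have : dot u u = 0 by rewrite -sqr_norm2 u0 expr0n.
move/eqP; rewrite psumr_eq0; last by move=> i _; rewrite -expr2 sqr_ge0.
move=> /allP h; apply/rowP => i; rewrite mxE.
by have /eqP := h i (mem_index_enum i); move/eqP; rewrite /= mulf_eq0 orbb => /eqP.
Qed.

Lemma norm2_gt0 u : u != 0 -> 0 < norm2 u.
Proof.
by move=> u0; rewrite lt_def norm2_ge0 andbT; apply: contra u0 => /eqP/norm2_eq0->.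
Qed.

Lemma norm2_le_sum u : norm2 u <= \sum_i `|u 0 i|.
Proof.
rewrite -(@ler_pXn2r _ 2) ?nnegrE ?norm2_ge0 ?sumr_ge0// sqr_norm2 expr2 big_distrl/=.
apply: ler_sum => i _; apply: (le_trans (ler_norm _)); rewrite normrM.
by apply: ler_wpM2l => //; rewrite (bigD1 i)//= lerDl sumr_ge0.
Qed.

Lemma dot_continuousl v : continuous (fun u => dot u v).
Proof.
apply: continuous_big => [|i _ u]; first exact: add_continuous.
by apply: continuousM; [exact: coord_continuous|exact: cst_continuous].
Qed.

End DotProduct.

Section DualNorm.
Context {R : realType} {d : nat} {N : 'rV[R]_d -> R} (N_norm : is_norm N).
Context {rho_lo rho_hi : R} (rho_lo_gt0 : 0 < rho_lo).
Context (rhoP : forall u : 'rV[R]_d,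
  rho_lo * norm2 u <= dual_norm N u <= rho_hi * norm2 u).
Implicit Types u v w : 'rV[R]_d.
Local Notation dualN := (dual_norm N).

Lemma is_norm0 : N 0 = 0.
Proof. by have [_ NZ _] := N_norm; rewrite -(scale0r 0) NZ normr0 mul0r. Qed.

Lemma is_normN u : N (- u) = N u.
Proof. by have [_ NZ _] := N_norm; rewrite -scaleN1r NZ normrN1 mul1r. Qed.

Lemma is_norm_ge0 u : 0 <= N u.
Proof.
have [ND _ _] := N_norm; have := ND u (- u).
by rewrite subrr is_norm0 is_normN -mulr2n pmulrn_lge0.
Qed.

Lemma is_norm_gt0 u : u != 0 -> 0 < N u.
Proof.
have [_ _ N0] := N_norm.
by move=> u0; rewrite lt_def is_norm_ge0 andbT; apply: contra u0 => /eqP/N0->.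
Qed.

Lemma is_normZ a u : N (a *: u) = `|a| * N u.
Proof. by have [_ NZ _] := N_norm. Qed.

Lemma is_normD u v : N (u + v) <= N u + N v.
Proof. by have [ND _ _] := N_norm. Qed.

(* The supremum of a set that is not bounded is 0, which [rhoP] forbids unless
   u = 0; no compactness is needed. *)
Lemma dual_norm_has_sup u : has_sup [set dot u v | v in [set v | N v <= 1]].
Proof.
have [->|u0] := eqVneq u 0.
  split; first by exists 0, 0 => /=; rewrite ?dot0l// is_norm0.
  by exists 0 => _ [v _ <-]; rewrite dot0l.
apply: contrapT => /sup_out; have /andP[+ _] := rhoP u.
rewrite /dual_norm => /[swap] ->; apply/negP; rewrite -ltNge.
by rewrite mulr_gt0// norm2_gt0.
Qed.

Lemma dual_norm_ub u v : N v <= 1 -> dot u v <= dualN u.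
Proof. by move=> v1; apply: ub_le_sup; [case: (dual_norm_has_sup u)|exists v]. Qed.

Lemma dual_norm_le u c : (forall v, N v <= 1 -> dot u v <= c) -> dualN u <= c.
Proof.
by move=> h; apply: ge_sup; [case: (dual_norm_has_sup u)|move=> _ [v v1 <-]; apply: h].
Qed.

Lemma dual_norm_ge0 u : 0 <= dualN u.
Proof. by rewrite -[leLHS](dot0l u) dotC dual_norm_ub// is_norm0. Qed.

Lemma dot_le_dual_norm u v : dot u v <= dualN u * N v.
Proof.
have [->|v0] := eqVneq v 0; first by rewrite dotC dot0l is_norm0 mulr0.
have Nv := is_norm_gt0 v0.
rewrite -ler_pdivrMr// mulrC -dotZr; apply: dual_norm_ub.
by rewrite is_normZ gtr0_norm ?invr_gt0// mulVf// gt_eqF.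
Qed.

Lemma dual_normD u v : dualN (u + v) <= dualN u + dualN v.
Proof. by apply: dual_norm_le => w w1; rewrite dotDl lerD// dual_norm_ub. Qed.

Lemma dual_norm_le_scale a u : dualN (a *: u) <= `|a| * dualN u.
Proof.
apply: dual_norm_le => w w1; rewrite dotZl -dotZr.
apply: (le_trans (dot_le_dual_norm _ _)); rewrite is_normZ mulrC.
rewrite -[leRHS]mulr1 -!mulrA ler_wpM2l// mulrC ler_wpM2l//; exact: dual_norm_ge0.
Qed.

Lemma dual_normZ a u : 0 <= a -> dualN (a *: u) <= a * dualN u.
Proof. by move=> a0; apply: (le_trans (dual_norm_le_scale _ _)); rewrite ger0_norm. Qed.

Lemma dual_normN u : dualN (- u) = dualN u.
Proof.
have h v : dualN (- v) <= dualN v.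
  by have := dual_norm_le_scale (-1) v; rewrite normrN1 mul1r scaleN1r.
by apply/eqP; rewrite eq_le h -{1}(opprK u) h.
Qed.

Lemma dual_norm_dist u v : `|dualN u - dualN v| <= dualN (u - v).
Proof.
rewrite ler_norml; apply/andP; split.
  rewrite -(dual_normN (u - v)) opprB lerNl opprB lerBlDr.
  by rewrite -[X in dualN X <= _](subrK u) dual_normD.
by rewrite lerBlDr -[X in dualN X <= _](subrK v) dual_normD.
Qed.

Lemma dual_norm0 : dualN 0 = 0.
Proof.
by apply/eqP; rewrite eq_le dual_norm_ge0 andbT dual_norm_le// => v _; rewrite dot0l.
Qed.

(** Pairing [u] with itself gives |u|_2^2 <= dualN u N(u), so an upper bound on the dual norm
    becomes a lower bound on [N]. *)
Lemma norm2_le_norm u : norm2 u <= rho_hi * N u.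
Proof.
have [->|u0] := eqVneq u 0.
  by rewrite is_norm0 mulr0 /norm2 dot0l sqrtr0.
have n0 := norm2_gt0 u0; have := dot_le_dual_norm u u.
rewrite -sqr_norm2 expr2 => h; rewrite -(ler_pM2l n0); apply: (le_trans h).
rewrite mulrA (mulrC (norm2 u)) ler_wpM2r ?is_norm_ge0//.
by have /andP[] := rhoP u.
Qed.

(** The dual norm is 1-Lipschitz for itself, and [rhoP] dominates it by a multiple of the sum of the
    absolute coordinates, which is continuous. *)
Lemma dual_norm_continuous : 0 < rho_hi -> continuous dualN.
Proof.
move=> rho0 u; apply/(@cvgrPdist_le _ _ _ (nbhs u) (nbhs_filter u)) => e e0.
have : continuous (fun v : 'rV[R]_d => rho_hi * \sum_i `|u 0 i - v 0 i|).
  move=> w; apply: continuousM; first exact: cst_continuous.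
  move: w; apply: continuous_big => [|i _ w]; first exact: add_continuous.
  apply: (@continuous_comp _ _ _ (fun v : 'rV[R]_d => u 0 i - v 0 i) (fun z => `|z|));
    last exact: norm_continuous.
  by apply: continuousB; [exact: cst_continuous|exact: coord_continuous].
move=> /(_ u); rewrite /continuous_at.
rewrite big1 => [|i _]; last by rewrite subrr normr0.
rewrite mulr0 => /(@cvgrPdist_le _ _ _ (nbhs u) (nbhs_filter u))/(_ e e0).
apply: filterS => v /=.
rewrite sub0r normrN => h; apply: (le_trans (dual_norm_dist _ _)).
have /andP[_ h2] := rhoP (u - v).
apply: (le_trans h2); apply: le_trans h; apply: le_trans (ler_norm _).
apply: ler_wpM2l; first exact: ltW.
apply: (le_trans (norm2_le_sum _)).
by apply: ler_sum => i _; rewrite !mxE.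
Qed.

(** Without boundedness [op_norm] would be the default value 0 and control nothing; a crude
    entrywise estimate is enough. *)
Lemma dual_norm_mulmx_has_ubound (A : 'M[R]_d) : 0 < rho_hi ->
  has_ubound [set dualN (u *m A) / N u | u in [set u | u != 0]].
Proof.
move=> rho0.
exists (rho_hi * \sum_j \sum_i rho_hi * `|A i j|) => _ [u /= u0 <-].
have Nu := is_norm_gt0 u0; rewrite ler_pdivrMr// -mulrA.
have /andP[_ h] := rhoP (u *m A); apply: (le_trans h).
apply: ler_wpM2l; first exact: ltW.
apply: (le_trans (norm2_le_sum _)).
rewrite big_distrl/=; apply: ler_sum => j _; rewrite mxE big_distrl/=.
apply: (le_trans (ler_norm_sum _ _ _)); apply: ler_sum => i _.
rewrite normrM mulrAC ler_wpM2r//; apply: le_trans (norm2_le_norm u).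
rewrite -(@ler_pXn2r _ 2) ?nnegrE ?norm2_ge0// sqr_norm2 real_normK ?num_real//.
by rewrite /dot (bigD1 i)//= -expr2 lerDl sumr_ge0// => k _; rewrite -expr2 sqr_ge0.
Qed.

Lemma op_norm_ge0 (A : 'M[R]_d) : 0 <= op_norm N A.
Proof.
rewrite /op_norm; set E := (X in sup X).
have [hs|/sup_out->//] := pselect (has_sup E).
have [[x Ex] ubE] := hs; apply: le_trans (ub_le_sup ubE Ex).
by case: Ex => u _ <-; rewrite divr_ge0// ?dual_norm_ge0 ?is_norm_ge0.
Qed.

Lemma dual_norm_mulmx_le (A : 'M[R]_d) u : 0 < rho_hi ->
  dualN (u *m A) <= op_norm N A * N u.
Proof.
move=> rho0; have [->|u0] := eqVneq u 0.
  by rewrite mul0mx dual_norm0 is_norm0 mulr0.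
rewrite -ler_pdivrMr ?is_norm_gt0//; apply: ub_le_sup.
  exact: dual_norm_mulmx_has_ubound.
by exists u.
Qed.

End DualNorm.

(** * Calculus along lines *)

Section LineDerivatives.
Context {R : realType} {d : nat}.
Implicit Types x u v w : 'rV[R]_d.

(** The arguments of [dot] are swapped so that the varying vector comes last and the map can be
    declared linear. *)
Definition dotr u v : R := dot v u.

Lemma dotr_linear u : linear (dotr u).
Proof. by move=> a v w; rewrite /dotr dotDl dotZl. Qed.

HB.instance Definition _ u :=
  GRing.isLinear.Build R 'rV[R]_d R _ (dotr u) (@dotr_linear u).

Lemma is_diff_line x v (t : R) :
  is_diff t (fun s : R => x + s *: v) (fun s : R => s *: v).
Proof.
have h : is_diff t (cst x + (fun s : R => s *: v)) (0 + (fun s : R => s *: v)).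
  exact: is_diffD.
apply: is_diff_eq h _; by rewrite add0r.
Qed.

Lemma dot_gradE (f : 'rV[R]_d -> R) x v : dot (grad f x) v = 'd f x v.
Proof.
rewrite {2}(row_sum_delta v) linear_sum; apply: eq_bigr => i _.
by rewrite mxE linearZ mulrC.
Qed.

Lemma is_derive_line (f : 'rV[R]_d -> R) x v (t : R) :
  differentiable f (x + t *: v) ->
  is_derive t 1 (fun s : R => f (x + s *: v)) (dot (grad f (x + t *: v)) v).
Proof.
move=> df; have dl := is_diff_line x v t.
have dc := is_diff_comp dl (differentiableP df).
have dd := @ex_diff _ _ _ _ _ _ _ dc.
apply: DeriveDef; first by apply: diff_derivable; exact: dd.
rewrite (deriveE _ dd).
by rewrite (@diff_val _ _ _ _ _ _ _ dc) dot_gradE /= scale1r.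
Qed.

(** Testing the gradient against a fixed [u] reduces the vector Taylor estimate to a real function
    of one variable. *)
Lemma is_derive_grad_line (f : 'rV[R]_d -> R) x u v (t : R) :
  differentiable (grad f) (x + t *: v) ->
  is_derive t 1 (fun s : R => dot (grad f (x + s *: v)) u)
    (dot (v *m hess f (x + t *: v)) u).
Proof.
move=> df; have dl := is_diff_line x v t.
have ddot : is_diff (grad f (x + t *: v)) (dotr u) (dotr u).
  have c : continuous (dotr u) by exact: dot_continuousl.
  apply: DiffDef; first exact: linear_differentiable.
  exact: diff_lin.
have dc := is_diff_comp (is_diff_comp dl (differentiableP df)) ddot.
have dd := @ex_diff _ _ _ _ _ _ _ dc.
apply: DeriveDef; first by apply: diff_derivable; exact: dd.
rewrite (deriveE _ dd).
rewrite (@diff_val _ _ _ _ _ _ _ dc) /= /dotr scale1r /hess /jacobian mul_rV_lin1 //.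
Qed.

Lemma grad_line_continuous (f : 'rV[R]_d -> R) x v :
  continuous (grad f) -> continuous (fun t : R => grad f (x + t *: v)).
Proof.
move=> cf t; apply: (@continuous_comp _ _ _ (fun t : R => x + t *: v)); last exact: cf.
by apply: differentiable_continuous; exact: (@ex_diff _ _ _ _ _ _ _ (is_diff_line x v t)).
Qed.

End LineDerivatives.

(** * Mean value and Gronwall estimates for real functions *)

Section RealFunctions.
Context {R : realType}.

(** This takes the place of integrating the derivative bound: the mean value theorem is applied to
    [psi] minus the cubic whose derivative is that bound. *)
Lemma le_increment_cubic (psi dpsi : R -> R) (p q s : R) :
  (forall t, is_derive t (1 : R) psi (dpsi t)) ->
  (forall t, 0 < t < 1 -> dpsi t <= p + 2 * q * t + 3 * s * t ^+ 2) ->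
  psi 1 - psi 0 <= p + q + s.
Proof.
move=> dP dle.
pose phi t := psi t - (p * t + q * t ^+ 2 + s * t ^+ 3).
have dphi t : is_derive t (1 : R) phi (dpsi t - (p + 2 * q * t + 3 * s * t ^+ 2)).
  have := dP t => dPt; apply: is_derive_eq.
  rewrite /GRing.scale /=; ring.
have cphi : {within `[0, 1], continuous phi}.
  apply: continuous_subspaceT => t; apply: differentiable_continuous.
  by apply/derivable1_diffP; have [] := dphi t.
have [c c01] := MVT ltr01 (fun t _ => dphi t) cphi.
rewrite in_itv/= in c01; have := dle _ c01; rewrite /phi.
nra.
Qed.

Lemma continuous_expRM (c : R) : continuous (fun s => expR (c * s)).
Proof.
move=> s; apply: (@continuous_comp _ _ _ (fun s => c * s) expR); last exact: continuous_expR.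
exact: mulrl_continuous.
Qed.

(* At a positive maximum c of G(t) exp(-bt), with b > a, stepping back by delta
   gives (1 - a delta)(1 + b delta) <= 1, which fails for small delta. *)
Lemma gronwall_sup_lt (G : R -> R) (a b : R) :
  0 <= a -> a < b -> continuous G -> (forall t, 0 <= G t) ->
  (forall s t M, 0 <= s -> s <= t -> t <= 1 ->
     (forall z, s <= z <= t -> G z <= M) -> G t - G s <= a * (t - s) * M) ->
  forall t, 0 <= t <= 1 -> G t <= G 0 * expR (b * t).
Proof.
move=> a0 ab cG G0 Ginc t t01.
have b0 : 0 < b by exact: le_lt_trans ab.
pose h s := G s * expR (- b * s).
have hE s : G s = h s * expR (b * s).
  by rewrite /h -mulrA -expRD mulNr addNr expR0 mulr1.
have ch : {within `[0, 1], continuous h}.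
  apply: continuous_subspaceT => s; apply: cvgM; first exact: cG.
  exact: continuous_expRM.
have [c c01 cmax] := EVT_max ler01 ch.
rewrite in_itv/= in c01; have /andP[c0 c1] := c01.
suff hc : h c <= h 0.
  have ht : h t <= h 0 by apply: le_trans hc; apply: cmax; rewrite in_itv.
  by rewrite hE ler_wpM2r ?expR_ge0// (le_trans ht)// /h mulr0 expR0 mulr1.
have [->//|cn0] := eqVneq c 0.
have cpos : 0 < c by rewrite lt_def cn0.
have [Gc0|Gcn0] := eqVneq (G c) 0.
  by rewrite /h Gc0 mul0r mulr_ge0// expR_ge0.
have Gc : 0 < G c by rewrite lt_def Gcn0 G0.
exfalso.
(* The second term forces [a * b * del < b - a], against the consequence [b - a <= a * b * del] of
   the final product inequality; the minimum with [c] keeps [c - del] in the interval. *)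
pose del := Num.min c ((b - a) / (a * b + 1)).
have ab1 : 0 < a * b + 1 by rewrite ltr_wpDl// mulr_ge0// ltW.
have del0 : 0 < del by rewrite lt_min cpos divr_gt0// subr_gt0.
have delc : del <= c by rewrite ge_min lexx.
have delab : del * (a * b + 1) <= b - a by rewrite -ler_pdivlMr// ge_min lexx orbT.
(* Maximality at [c] serves twice: it bounds [G] by [G c] just before [c], and it makes
   [G (c - del)] smaller by an exponential factor. *)
have Gle z : 0 <= z <= c -> G z <= G c * expR (- b * (c - z)).
  move=> /andP[z0 zc]; rewrite (hE z).
  have -> : expR (- b * (c - z)) = expR (- b * c) * expR (b * z).
    by rewrite -expRD; congr expR; ring.
  rewrite mulrA ler_wpM2r ?expR_ge0//; apply: cmax.
  by rewrite in_itv/= z0 (le_trans zc c1).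
have cd0 : 0 <= c - del by rewrite subr_ge0.
have := Ginc (c - del) c (G c) cd0 _ c1.
rewrite lerBlDr lerDl (ltW del0) => /(_ isT).
have -> : c - (c - del) = del by ring.
move=> inc.
have {}inc : G c - G (c - del) <= a * del * G c.
  apply: inc => z /andP[zl zc]; have zz : 0 <= z <= c by rewrite zc (le_trans cd0 zl).
  apply: le_trans (Gle z zz) _; rewrite ger_pMr// -[leRHS]expR0 ler_expR mulNr oppr_le0.
  by rewrite mulr_ge0 ?(ltW b0)// subr_ge0.
have := Gle (c - del); rewrite cd0 lerBlDr lerDl (ltW del0) => /(_ isT).
have -> : c - (c - del) = del by ring.
set e := expR _ => Gs.
have e1 : e * (1 + b * del) <= 1.
  rewrite [leRHS](_ : _ = e * expR (b * del)); last first.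
    by rewrite /e -expRD mulNr addNr expR0.
  by apply: ler_wpM2l; [exact: expR_ge0|exact: expR_ge1Dx].
have h1 : 1 - a * del <= e.
  rewrite -(ler_pM2l Gc); nra.
have h2 : (1 - a * del) * (1 + b * del) <= 1.
  by apply: le_trans e1; rewrite ler_wpM2r// addr_ge0// mulr_ge0 ?ltW.
have h3 : del * (b - a) <= del * (a * b * del) by nra.
rewrite ler_pM2l// in h3; nra.
Qed.

(** The rate [a] itself is reached by letting [b] decrease to [a]. *)
Lemma gronwall_sup (G : R -> R) (a : R) :
  0 <= a -> continuous G -> (forall t, 0 <= G t) ->
  (forall s t M, 0 <= s -> s <= t -> t <= 1 ->
     (forall z, s <= z <= t -> G z <= M) -> G t - G s <= a * (t - s) * M) ->
  forall t, 0 <= t <= 1 -> G t <= G 0 * expR (a * t).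
Proof.
move=> a0 cG G0 Ginc t t01.
have h b : a < b -> G t <= G 0 * expR (b * t).
  by move=> ab; exact: gronwall_sup_lt Ginc t t01.
have cvg : G 0 * expR (b * t) @[b --> a^'+] --> G 0 * expR (a * t).
  apply: cvg_at_right_filter; apply: cvgMl_tmp.
  under eq_fun do rewrite mulrC; rewrite mulrC.
  exact: continuous_expRM.
apply: (cvgr_to_ge cvg); near=> b; apply: h.
by near: b; exact: nbhs_right_gt.
Unshelve. all: by end_near.
Qed.

End RealFunctions.

(** * Generalized smoothness *)

Section GeneralizedSmoothness.
Context {R : realType} {d : nat} (d_gt0 : (0 < d)%N).
Context {N : 'rV[R]_d -> R} (N_norm : is_norm N).
Context {rho_lo rho_hi : R} (rho_lo_gt0 : 0 < rho_lo) (rho_hi_gt0 : 0 < rho_hi).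
Context (rhoP : forall u : 'rV[R]_d,
  rho_lo * norm2 u <= dual_norm N u <= rho_hi * norm2 u).
Context {f : 'rV[R]_d -> R} (f_diff2 : twice_differentiable f).
Context {L0 L1 : R} (L1_gt0 : 0 < L1) (A3 : symmetric_lipschitz_grad N f L0 L1).
Implicit Types x v : 'rV[R]_d.

Local Notation gnorm x := (dual_norm N (grad f x)).

Lemma grad_continuous : continuous (grad f).
Proof. by move=> x; apply: differentiable_continuous; case: f_diff2 => _. Qed.

Lemma gnorm_line_continuous x v : continuous (fun t : R => gnorm (x + t *: v)).
Proof.
move=> t; apply: (@continuous_comp _ _ _ (fun t : R => grad f (x + t *: v))).
  exact/grad_line_continuous/grad_continuous.
exact: (dual_norm_continuous N_norm rho_lo_gt0 rhoP).
Qed.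

Lemma sup_grad_segment_le x v (s t M : R) :
  s <= t -> (forall z, s <= z <= t -> gnorm (x + z *: v) <= M) ->
  sup_grad_segment N f (x + t *: v) (x + s *: v) <= M.
Proof.
move=> st h; apply: ge_sup.
  exists (gnorm (0 *: (x + t *: v) + (1 - 0) *: (x + s *: v))), 0 => //=.
  by rewrite in_itv/= lexx ler01.
move=> _ [th /= + <-]; rewrite in_itv/= => /andP[th0 th1].
have -> : th *: (x + t *: v) + (1 - th) *: (x + s *: v)
    = x + (s + th * (t - s)) *: v.
  by apply/rowP => i; rewrite !mxE; ring.
by apply: h; apply/andP; split; nra.
Qed.

Lemma grad_line_lipschitz x v (s t M : R) :
  s <= t -> (forall z, s <= z <= t -> gnorm (x + z *: v) <= M) ->
  dual_norm N (grad f (x + t *: v) - grad f (x + s *: v))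
    <= (L0 + L1 * M) * ((t - s) * N v).
Proof.
move=> st h; apply: (le_trans (A3 _ _)).
have -> : x + t *: v - (x + s *: v) = (t - s) *: v.
  by rewrite opprD addrACA subrr add0r scalerBl.
rewrite (is_normZ N_norm) ger0_norm ?subr_ge0// ler_wpM2r//.
  by rewrite mulr_ge0 ?subr_ge0// is_norm_ge0.
by rewrite lerD2l ler_pM2l// sup_grad_segment_le.
Qed.

(** By continuity, on a short enough segment [M] can be taken arbitrarily close to the gradient norm
    at [x]. The constants are general so that the gradient and the Hessian condition are both
    covered. *)
Lemma nonneg_of_gnorm_near (c0 c1 : R) x (v : 'rV[R]_d) : 0 < c1 ->
  (forall t M, 0 < t -> (forall z, 0 <= z <= t -> gnorm (x + z *: v) <= M) ->
     0 <= c0 + c1 * M) ->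
  0 <= c0 + c1 * gnorm x.
Proof.
move=> c1_gt0 h; apply/ler_addgt0Pr => e e0.
have e1 : 0 < e / c1 by rewrite divr_gt0.
have /cvgrPdist_le/(_ _ e1)/nbhs_ballP[t/= t0 ht] := @gnorm_line_continuous x v 0.
have := h (t / 2) (gnorm x + e / c1); rewrite divr_gt0// => /(_ isT).
have -> : c0 + c1 * (gnorm x + e / c1) = c0 + c1 * gnorm x + e.
  by rewrite mulrDr mulrCA divff ?gt_eqF// mulr1 addrA.
apply => z /andP[z0 zt].
have : `|gnorm (x + 0 *: v) - gnorm (x + z *: v)| <= e / c1.
  apply: ht; rewrite /ball/= sub0r normrN ger0_norm//; apply: (le_lt_trans zt).
  by rewrite ltr_pdivrMr// ltr_pMr// ltr1n.
by rewrite scale0r addr0 distrC ler_distl => /andP[].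
Qed.

(** The local Lipschitz constant of the gradient. Its growth inequality is homogeneous, as Gronwall
    requires, while that of the gradient norm is not. *)
Definition gscale x := L0 + L1 * gnorm x.

(** A negative value would make the bound on a norm negative along a nonzero direction, and [d_gt0]
    supplies such a direction. *)
Lemma gscale_ge0 x : 0 <= gscale x.
Proof.
pose v : 'rV[R]_d := delta_mx 0 (Ordinal d_gt0).
have v0 : v != 0.
  by apply/eqP => /rowP/(_ (Ordinal d_gt0)); rewrite !mxE !eqxx; apply/eqP/oner_neq0.
apply: (@nonneg_of_gnorm_near _ _ x v) => // t M t0 hM.
have := @grad_line_lipschitz x v 0 t M (ltW t0) hM.
move/(le_trans (dual_norm_ge0 N_norm rho_lo_gt0 rhoP _)).
by rewrite subr0 pmulr_lge0// mulr_gt0// is_norm_gt0.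
Qed.

Lemma gscale_growth x v r t : N v <= r -> 0 <= t <= 1 ->
  gscale (x + t *: v) <= gscale x * expR (L1 * r * t).
Proof.
move=> vr t01; have r0 : 0 <= r by apply: le_trans vr; exact: is_norm_ge0.
rewrite -[X in gscale X * _]addr0 -(scale0r v).
apply: (@gronwall_sup _ (fun t => gscale (x + t *: v)) (L1 * r)) => //.
- by rewrite mulr_ge0// ltW.
- move=> s; apply: cvgD; first exact: cvg_cst.
  by apply: cvgMl_tmp; exact: gnorm_line_continuous.
- by move=> s; exact: gscale_ge0.
move=> s s' M s0 ss' s'1.
have scale (a b : R) : a - b <= M * ((s' - s) * r) ->
    L0 + L1 * a - (L0 + L1 * b) <= L1 * r * (s' - s) * M.
  by rewrite -(ler_pM2l L1_gt0) => ab; lra.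
move=> hM; rewrite /gscale.
have M0 : 0 <= M by apply: le_trans (hM s _); rewrite ?gscale_ge0// lexx.
(* A bound [M] on [gscale] is the bound [(M - L0) / L1] on the gradient norm. *)
have := @grad_line_lipschitz x v s s' ((M - L0) / L1) ss'.
have h z : s <= z <= s' -> gnorm (x + z *: v) <= (M - L0) / L1.
  by move=> /hM; rewrite /gscale ler_pdivlMr// lerBrDl mulrC.
move=> /(_ h); rewrite [L1 * ((M - L0) / L1)]mulrC divfK ?gt_eqF// [L0 + _]addrC subrK => lip.
have hd : gnorm (x + s' *: v) - gnorm (x + s *: v) <= M * ((s' - s) * N v).
  apply: le_trans lip; apply: le_trans (ler_norm _) _.
  exact: (dual_norm_dist N_norm rho_lo_gt0 rhoP).
have hr : M * ((s' - s) * N v) <= M * ((s' - s) * r).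
  by rewrite ler_wpM2l// ler_wpM2l// subr_ge0.
exact: scale (le_trans hd hr).
Qed.

Lemma grad_line_dist x v r t : N v <= r -> 0 <= t <= 1 ->
  dual_norm N (grad f (x + t *: v) - grad f x)
    <= gscale x * expR (L1 * r) * (t * r).
Proof.
move=> vr /andP[t0 t1]; have r0 : 0 <= r by apply: le_trans vr; exact: is_norm_ge0.
rewrite -[X in _ - grad f X]addr0 -(scale0r v).
pose C := gscale x * expR (L1 * r).
have := @grad_line_lipschitz x v 0 t ((C - L0) / L1) t0.
have h z : 0 <= z <= t -> gnorm (x + z *: v) <= (C - L0) / L1.
  move=> /andP[z0 zt]; rewrite ler_pdivlMr// lerBrDl mulrC.
  have z1 : z <= 1 := le_trans zt t1.
  apply: le_trans (@gscale_growth x v r z vr _) _; first by rewrite z0.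
  rewrite ler_wpM2l ?gscale_ge0// ler_expR -[leRHS]mulr1 ler_wpM2l//.
  by rewrite mulr_ge0// ltW.
move=> /(_ h) /le_trans; apply.
rewrite [L1 * ((C - L0) / L1)]mulrC divfK ?gt_eqF// [L0 + _]addrC subrK subr0.
by rewrite ler_wpM2l ?ler_wpM2l// /C mulr_ge0 ?gscale_ge0 ?expR_ge0.
Qed.

Lemma descent x v r : N v <= r ->
  f (x + v) <= f x + dot (grad f x) v + gscale x * expR (L1 * r) * r ^+ 2 / 2.
Proof.
move=> vr; have r0 : 0 <= r by apply: le_trans vr; exact: is_norm_ge0.
have [fd _] := f_diff2.
pose C := gscale x * expR (L1 * r).
have C0 : 0 <= C by rewrite mulr_ge0 ?gscale_ge0 ?expR_ge0.
have := @le_increment_cubic _ (fun t : R => f (x + t *: v))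
  (fun t => dot (grad f (x + t *: v)) v) (dot (grad f x) v) (C * r ^+ 2 / 2) 0.
rewrite scale1r scale0r addr0 addr0 lerBlDl addrA; apply.
  by move=> t; exact: is_derive_line.
move=> t /andP[t0 t1]; rewrite mulr0 mul0r addr0 -lerBlDl -dotNl -dotDl.
apply: le_trans (dot_le_dual_norm N_norm rho_lo_gt0 rhoP _ _) _.
apply: le_trans (ler_wpM2l (dual_norm_ge0 N_norm rho_lo_gt0 rhoP _) vr) _.
have := @grad_line_dist x v r t vr; rewrite (ltW t0) (ltW t1) => /(_ isT).
move=> /(ler_wpM2r r0)/le_trans; apply.
by rewrite -/C; move: (C) => c; rewrite le_eqVlt; apply/orP; left; apply/eqP; field.
Qed.

Context {M0 M1 : R} (M1_gt0 : 0 < M1) (A4 : symmetric_lipschitz_hess N f M0 M1).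

Lemma hess_line_lipschitz x v (t M : R) :
  0 <= t -> (forall z, 0 <= z <= t -> gnorm (x + z *: v) <= M) ->
  op_norm N (hess f (x + t *: v) - hess f x) <= (M0 + M1 * M) * (t * N v).
Proof.
move=> t0 h; apply: (le_trans (A4 _ _)).
rewrite addrAC subrr add0r (is_normZ N_norm) ger0_norm// ler_wpM2r//.
  by rewrite mulr_ge0// is_norm_ge0.
rewrite lerD2l ler_pM2l// -[X in sup_grad_segment _ _ _ X]addr0 -(scale0r v).
exact: sup_grad_segment_le.
Qed.

Lemma hscale_ge0 x : 0 <= M0 + M1 * gnorm x.
Proof.
pose v : 'rV[R]_d := delta_mx 0 (Ordinal d_gt0).
have v0 : v != 0.
  by apply/eqP => /rowP/(_ (Ordinal d_gt0)); rewrite !mxE !eqxx; apply/eqP/oner_neq0.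
apply: (@nonneg_of_gnorm_near _ _ x v) => // t M t0 hM.
have := @hess_line_lipschitz x v t M (ltW t0) hM.
move/(le_trans (op_norm_ge0 N_norm rho_lo_gt0 rhoP _)).
by rewrite pmulr_lge0// mulr_gt0// is_norm_gt0.
Qed.

(** On the segment the gradient norm is at most [gnorm x + C * (t * r)], so the Hessian increment is
    bounded by a combination of [t] and [t^2]; integration produces the factors 1/2 and 1/3. *)
Lemma grad_taylor x v r : N v <= r ->
  dual_norm N (grad f (x + v) - grad f x - v *m hess f x)
    <= r ^+ 2 * (M0 / 2 + M1 * (gnorm x / 2 + gscale x * expR (L1 * r) * r / 3)).
Proof.
move=> vr; have r0 : 0 <= r by apply: le_trans vr; exact: is_norm_ge0.
have [_ gd] := f_diff2.
pose C := gscale x * expR (L1 * r).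
have C0 : 0 <= C by rewrite mulr_ge0 ?gscale_ge0 ?expR_ge0.
apply: (dual_norm_le N_norm rho_lo_gt0 rhoP) => u u1.
have := @le_increment_cubic _ (fun t : R => dot (grad f (x + t *: v)) u)
  (fun t => dot (v *m hess f (x + t *: v)) u) (dot (v *m hess f x) u)
  (r ^+ 2 * (M0 / 2 + M1 * gnorm x / 2)) (r ^+ 2 * (M1 * C * r / 3)).
rewrite scale1r scale0r addr0 => h.
have {}h := h (fun t => @is_derive_grad_line _ _ f x u v t (gd _)).
rewrite !dotDl !dotNl lerBlDr addrC.
rewrite addrC; apply: le_trans (h _) _; last first.
  rewrite -/C; move: (gnorm x) (C) (dot _ _) => g c e.
  by rewrite le_eqVlt; apply/orP; left; apply/eqP; field.
move=> t /andP[t0 t1]; rewrite -addrA -lerBlDl -dotNl -dotDl -mulmxBr.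
apply: le_trans (dot_le_dual_norm N_norm rho_lo_gt0 rhoP _ _) _.
apply: le_trans (ler_wpM2l (dual_norm_ge0 N_norm rho_lo_gt0 rhoP _) u1) _.
rewrite mulr1; apply: le_trans (dual_norm_mulmx_le N_norm rho_lo_gt0 rhoP _ _ rho_hi_gt0) _.
have := @hess_line_lipschitz x v t (gnorm x + C * (t * r)) (ltW t0).
have hM z : 0 <= z <= t -> gnorm (x + z *: v) <= gnorm x + C * (t * r).
  move=> /andP[z0 zt]; rewrite -lerBlDl; apply: (le_trans (ler_norm _)).
  apply: (le_trans (dual_norm_dist N_norm rho_lo_gt0 rhoP _ _)).
  have z1 : 0 <= z <= 1 by rewrite z0 (le_trans zt)// ltW.
  apply: le_trans (@grad_line_dist x v r z vr z1) _.
  by rewrite ler_wpM2l// ler_wpM2r.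
move=> /(_ hM) hop.
apply: le_trans (ler_wpM2r (is_norm_ge0 N_norm v) hop) _.
have H0 : 0 <= M0 + M1 * (gnorm x + C * (t * r)).
  rewrite mulrDr addrA addr_ge0 ?hscale_ge0//.
  apply: mulr_ge0; first exact: ltW.
  by apply: mulr_ge0 => //; apply: mulr_ge0 => //; exact: ltW.
apply: (@le_trans _ _ ((M0 + M1 * (gnorm x + C * (t * r))) * (t * r) * r)).
  rewrite -2!mulrA; apply: ler_wpM2l => //; rewrite -2!mulrA.
  apply: ler_wpM2l; first exact: ltW.
  by apply: ler_pM => //; exact: is_norm_ge0.
move: (gnorm x) (C) => g c.
by rewrite le_eqVlt; apply/orP; left; apply/eqP; field.
Qed.

End GeneralizedSmoothness.

(** * Points of small gradient and the signs of [L0] and [M0] *)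

Section GradientInfimum.
Context {R : realType} {d : nat} (d_gt0 : (0 < d)%N).
Context {N : 'rV[R]_d -> R} (N_norm : is_norm N).
Context {rho_lo rho_hi : R} (rho_lo_gt0 : 0 < rho_lo) (rho_hi_gt0 : 0 < rho_hi).
Context (rhoP : forall u : 'rV[R]_d,
  rho_lo * norm2 u <= dual_norm N u <= rho_hi * norm2 u).
Context {f : 'rV[R]_d -> R} (f_diff2 : twice_differentiable f).
Context {L0 L1 : R} (L1_gt0 : 0 < L1) (A3 : symmetric_lipschitz_grad N f L0 L1).
Context (A2 : has_lbound (range f)).

Local Notation gnorm x := (dual_norm N (grad f x)).
Local Notation Gs x := (@gscale _ _ N f L0 L1 x).

(** Half of the supremum is asked for because attainment has not been proved. *)
Lemma exists_half_dual_norm (u : 'rV[R]_d) : 0 < dual_norm N u ->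
  exists2 v, N v <= 1 & dual_norm N u / 2 <= dot u v.
Proof.
move=> u0; apply: contrapT => h.
suff : dual_norm N u <= dual_norm N u / 2.
  by rewrite leNgt => /negP; apply; rewrite ltr_pdivrMr// ltr_pMr// ltr1n.
apply: (dual_norm_le N_norm rho_lo_gt0 rhoP) => v v1.
by rewrite leNgt; apply/negP => /ltW uv; apply: h; exists v.
Qed.

(* If the gradient stayed away from 0, gradient steps of a fixed small length
   would decrease f by a fixed amount, so f would be unbounded below. *)
Lemma exists_small_gradient (c : R) : 0 < c -> exists x, gnorm x < c.
Proof.
move=> c0; apply: contrapT => h.
have {}h x : c <= gnorm x by rewrite leNgt; apply/negP => hx; apply: h; exists x.
(* [Q * gnorm x] dominates [gscale x] wherever the gradient norm is at least [c]. *)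
pose Q := `|L0| / c + L1.
have Q0 : 0 < Q by rewrite ltr_wpDl// divr_ge0// ltW.
have E0 : 0 < expR L1 by exact: expR_gt0.
(* Small enough for the quadratic term to cost at most half of the linear gain [r * g / 2], which
   leaves a decrease of at least [r * c / 4]; moreover [r <= 1] bounds the exponential by
   [expR L1]. *)
pose r := (2 * (Q * expR L1) + 1)^-1.
have den0 : 0 < 2 * (Q * expR L1) + 1 by rewrite ltr_wpDl// mulr_ge0// mulr_ge0 ?ltW.
have r0 : 0 < r by rewrite invr_gt0.
have r1 : r <= 1 by rewrite invf_le1// lerDr mulr_ge0// mulr_ge0 ?ltW.
have rQ : Q * expR L1 * r <= 2^-1.
  rewrite /r ler_pdivrMr//; move: (Q * expR L1) => z; lra.
have alg (G D g y : R) : c <= g -> G * r <= g / 2 -> g / 2 <= D ->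
    y + - r * D + G * r ^+ 2 / 2 <= y - r * c / 4.
  move=> /(ler_wpM2l (ltW r0)) + /(ler_wpM2l (ltW r0)) + /(ler_wpM2l (ltW r0)).
  by move=> h1 h2 h3; lra.
have step x : exists x', f x' <= f x - r * c / 4.
  have gx : 0 < gnorm x := lt_le_trans c0 (h x).
  have [w w1 hw] := exists_half_dual_norm gx.
  exists (x + (- r) *: w).
  have Nv : N ((- r) *: w) <= r.
    by rewrite (is_normZ N_norm) normrN gtr0_norm// ler_piMr// ltW.
  apply: (le_trans (descent d_gt0 N_norm rho_lo_gt0 rho_hi_gt0 rhoP f_diff2 L1_gt0 A3 x Nv)).
  have Gx : Gs x <= Q * gnorm x.
    rewrite /gscale /Q mulrDl lerD2r; apply: (le_trans (ler_norm _)).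
    by rewrite -mulrA ler_peMr// mulrC ler_pdivlMr// mul1r.
  have Ex : expR (L1 * r) <= expR L1 by rewrite ler_expR ler_piMr// ltW.
  have G0 := gscale_ge0 d_gt0 N_norm rho_lo_gt0 rho_hi_gt0 rhoP f_diff2 L1_gt0 A3 x.
  have h1 : Gs x * expR (L1 * r) <= Q * gnorm x * expR L1.
    by apply: ler_pM => //; exact: expR_ge0.
  have h2 : Gs x * expR (L1 * r) * r <= gnorm x / 2.
    apply: (le_trans (ler_wpM2r (ltW r0) h1)).
    rewrite -(mulrA Q) (mulrCA Q) -!(mulrA (gnorm x)).
    by rewrite ler_wpM2l// ltW.
  rewrite dotZr.
  exact: alg (h x) h2 hw.
have [b fb] := A2.
have iter_step n : exists x, f x <= f 0 - n%:R * (r * c / 4).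
  elim: n => [|n [x hx]]; first by exists 0; rewrite mul0r subr0.
  have [x' hx'] := step x; exists x'; apply: (le_trans hx').
  by rewrite -[n.+1%:R]natr1 mulrDl mul1r opprD addrA lerD2r.
have rc : 0 < r * c / 4 by rewrite divr_gt0// mulr_gt0.
have [n hn] : exists n : nat, (f 0 - b) / (r * c / 4) < n%:R.
  exists (Num.bound `|(f 0 - b) / (r * c / 4)|).
  by apply: le_lt_trans (ler_norm _) _; exact: archi_boundP.
have [x hx] := iter_step n.
have := fb (f x) (ex_intro2 _ _ x I erefl).
move: hn; rewrite ltr_pdivrMr// ltrBlDr -ltrBlDl => hn.
by move=> /le_trans/(_ hx); rewrite leNgt hn.
Qed.

Lemma scale_const_ge0 (c0 c1 : R) : 0 < c1 ->
  (forall x, 0 <= c0 + c1 * gnorm x) -> 0 <= c0.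
Proof.
move=> c1_gt0 h; apply/ler_addgt0Pr => e e0.
have [x hx] := exists_small_gradient (divr_gt0 e0 c1_gt0).
apply: (le_trans (h x)); rewrite lerD2l.
by rewrite mulrC -ler_pdivlMr// ltW.
Qed.

Lemma grad_lipschitz_const_ge0 : 0 <= L0.
Proof.
apply: (scale_const_ge0 L1_gt0) => z.
exact: (gscale_ge0 d_gt0 N_norm rho_lo_gt0 rho_hi_gt0 rhoP f_diff2 L1_gt0 A3 z).
Qed.

Lemma hess_lipschitz_const_ge0 (M0 M1 : R) : 0 < M1 ->
  symmetric_lipschitz_hess N f M0 M1 -> 0 <= M0.
Proof.
move=> M1_gt0 A4; apply: (scale_const_ge0 M1_gt0) => z.
exact: (hscale_ge0 d_gt0 N_norm rho_lo_gt0 rho_hi_gt0 rhoP f_diff2 M1_gt0 A4 z).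
Qed.

End GradientInfimum.

(** * Deterministic bound along a trajectory *)

(** The recursion telescopes. The induction carries the last term [b j], which at the end dominates
    [a * b n] because [a <= 1]. *)
Lemma sum_geometric_recursion {R : realFieldType} (a : R) (b z : nat -> R) (n : nat) :
  0 <= a -> a <= 1 -> (forall k, 0 <= b k) ->
  (forall k, (k < n)%N -> b k.+1 <= (1 - a) * b k + z k) ->
  a * \sum_(k < n.+1) b k <= b 0%N + \sum_(k < n) z k.
Proof.
move=> a0 a1 b0 brec.
suff h : forall j, (j <= n)%N ->
    a * \sum_(k < j) b k + b j <= b 0%N + \sum_(k < j) z k.
  rewrite big_ord_recr/= mulrDr; apply: le_trans (h n (leqnn n)).
  by rewrite lerD2l ler_piMl.
elim=> [|j IH] jn; first by rewrite !big_ord0 mulr0 add0r addr0.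
rewrite !big_ord_recr/= mulrDr; have := brec j jn; have := IH (ltnW jn).
move: (\sum_(i < j) b i) (\sum_(i < j) z i) (b j) (b j.+1) (z j) => B Z bj bj' zj.
lra.
Qed.

(** [h] and [h'] will be the images under the Hessian of the two displacements; since their weighted
    sum vanishes, they can be inserted at no cost. *)
Lemma momentum_error_split {R : realFieldType} {n : nat} (a : R)
    (m g gy gx gx' V h h' : 'rV[R]_n) :
  (1 - a) *: h + a *: h' = 0 ->
  (1 - a) *: m + a *: g - gx' - ((1 - a) *: V + a *: (g - gy))
    = (1 - a) *: (m - gx - V)
      + ((1 - a) *: (gx - gx' - h) + a *: (gy - gx' - h')).
Proof. by move=> /rowP lin; apply/rowP => i; have := lin i; rewrite !mxE; lra. Qed.

Lemma extrapolation_cancel {R : fieldType} {V : lmodType R} (a : R) (x x' y : V) :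
  a != 0 -> y = x' + ((1 - a) / a) *: (x' - x) ->
  (1 - a) *: (x - x') + a *: (y - x') = 0.
Proof.
move=> a0 ->; rewrite [x' + _]addrC addrK scalerA [a * _]mulrC divfK//.
by rewrite -scalerDr addrA subrK subrr scaler0.
Qed.

(** [gam], [eps], [u], [v] and [phi] stand for the norms of the gradient, of the momentum error, of
    its drift and noise parts, and for the values of f; [E] is [expR (L1 * rad)]. Gradient norms
    return on the right with total weight 4/27 + 1/4 < 1/2 in front of [eta * S]; moving them to the
    left explains the overall factor 2. *)
Lemma sum_gradient_bound {R : realFieldType} (K : nat) (a eta rad L0 L1 M0 M1 E finf : R)
    (gam eps u v phi : nat -> R) :
  0 < a -> a <= 1 -> 0 < eta -> 0 < rad -> 0 <= L0 -> 0 < L1 -> 0 <= M0 ->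
  0 < M1 -> 0 <= E -> E <= 3 / 2 -> eta <= rad -> L1 * rad <= 1 / 3 ->
  M1 * (eta / a) ^+ 2 <= 1 / 9 ->
  (forall k, 0 <= gam k) -> (forall k, 0 <= u k) ->
  (forall k, eps k <= u k + v k) -> (forall k, finf <= phi k) ->
  (forall k, (k <= K)%N -> u k.+1 <= (1 - a) * u k
     + eta ^+ 2 / a * (M0 / 2 + M1 * (gam k.+1 / 2 + (L0 + L1 * gam k.+1) * E * rad / 3))) ->
  (forall k, (k <= K)%N -> eta * gam k <= phi k - phi k.+1 + 2 * eta * eps k
     + (L0 + L1 * gam k) * E * eta ^+ 2 / 2) ->
  eta * \sum_(k < K.+1) gam k <= 2 * (phi 0%N - finf)
    + 4 * eta * (\sum_(k < K.+1) v k + u 0%N / a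
        + K.+1%:R * ((eta / a) ^+ 2 * (M0 / 2 + M1 * L0 * E * rad / 3)))
    + K.+1%:R * (L0 * E * eta ^+ 2).
Proof.
move=> a0 a1 eta0 rad0 L00 L10 M00 M10 E0 E1 etar L1r M1r gam0 u0 epsE finfP uS phiS.
pose S := \sum_(k < K.+1) gam k; pose n : R := K.+1%:R.
have n0 : 0 <= n by [].
have S0 : 0 <= S by exact: sumr_ge0.
pose w t := M0 / 2 + M1 * L0 * E * rad / 3 + M1 * (1 / 2 + L1 * E * rad / 3) * t.
have w_ge0 t : 0 <= t -> 0 <= w t.
  have [L1' M1' rad'] := And3 (ltW L10) (ltW M10) (ltW rad0).
  move=> t0; apply: addr_ge0; first by apply: addr_ge0; rewrite divr_ge0// !mulr_ge0.
  by rewrite !mulr_ge0// addr_ge0// divr_ge0// !mulr_ge0.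
have usum : a * \sum_(k < K.+1) u k <= u 0%N + eta ^+ 2 / a * \sum_(k < K) w (gam k.+1).
  rewrite [X in _ + X]mulr_sumr.
  apply: (sum_geometric_recursion (z := fun k => eta ^+ 2 / a * w (gam k.+1))) => //.
    exact: ltW.
  move=> k kK; apply: (le_trans (uS k (ltnW kK))); rewrite lerD2l.
  by rewrite le_eqVlt; apply/orP; left; apply/eqP; rewrite /w; field; rewrite gt_eqF.
(* The recursion yields the indices 1 to K only; the nonnegative term of index 0 is added to
   complete the sum. *)
have wsum : \sum_(k < K) w (gam k.+1) <= n * (M0 / 2 + M1 * L0 * E * rad / 3)
    + M1 * (1 / 2 + L1 * E * rad / 3) * S.
  apply: (@le_trans _ _ (\sum_(k < K.+1) w (gam k))).
    by rewrite [leRHS]big_ord_recl/= lerDr w_ge0.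
  by rewrite /w big_split/= sumr_const card_ord -mulr_sumr -/S mulrC mulr_natl.
have tele : eta * S <= phi 0%N - phi K.+1 + 2 * eta * \sum_(k < K.+1) eps k
    + E * eta ^+ 2 / 2 * (n * L0 + L1 * S).
  rewrite [n * L0]mulr_natl /S 3!mulr_sumr.
  have -> : L0 *+ K.+1 = \sum_(k < K.+1) L0 by rewrite sumr_const card_ord.
  rewrite -big_split/= mulr_sumr.
  have -> : phi 0%N - phi K.+1 = \sum_(k < K.+1) (phi k - phi k.+1).
    rewrite -(big_mkord xpredT (fun k => phi k - phi k.+1)).
    rewrite (@telescope_sumr_eq _ _ _ (fun k => - phi k))//; first by rewrite opprK addrC.
    by move=> k _; rewrite opprK addrC.
  rewrite -2!big_split/=; apply: ler_sum => k _.
  apply: le_trans (phiS k (ltn_ord k)) _; rewrite lerD2l.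
  by rewrite le_eqVlt; apply/orP; left; apply/eqP; field.
have epssum : \sum_(k < K.+1) eps k <= \sum_(k < K.+1) u k + \sum_(k < K.+1) v k.
  by rewrite -big_split; apply: ler_sum => k _; exact: epsE.
have fK := finfP K.+1.
move: usum wsum tele epssum; rewrite -/S -/n.
set U := \sum_(k < K.+1) u k; set W := \sum_(k < K) _; set Ep := \sum_(k < K.+1) eps k.
set V := \sum_(k < K.+1) v k; set c0 := M0 / 2 + _.
move=> usum wsum tele epssum.
have Ule : U <= u 0%N / a + (eta / a) ^+ 2 * (n * c0 + M1 * (1 / 2 + L1 * E * rad / 3) * S).
  rewrite -(ler_pM2l a0); apply: (le_trans usum).
  rewrite [leRHS](_ : _ = u 0%N
    + eta ^+ 2 / a * (n * c0 + M1 * (1 / 2 + L1 * E * rad / 3) * S)); last first.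
    by field; rewrite gt_eqF.
  by rewrite lerD2l; apply: ler_wpM2l => //; rewrite divr_ge0 ?sqr_ge0 ?ltW.
have LE : L1 * E * rad <= 1 / 2.
  rewrite mulrAC; apply: (@le_trans _ _ (1 / 3 * (3 / 2))); last by lra.
  by apply: ler_pM => //; rewrite mulr_ge0 ?ltW.
(* The factor 1/9 comes from [M1 * (eta / a) ^+ 2], and 2/3 from 1/2 + (1/2)/3 by [LE]. *)
have coef1 : (eta / a) ^+ 2 * (M1 * (1 / 2 + L1 * E * rad / 3) * S) <= 2 / 27 * S.
  rewrite mulrA; apply: ler_wpM2r => //; rewrite mulrA [_ ^+ 2 * M1]mulrC.
  apply: (@le_trans _ _ (1 / 9 * (2 / 3))); last by lra.
  apply: ler_pM => //; last by lra.
    by rewrite mulr_ge0 ?sqr_ge0 ?ltW.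
  by rewrite addr_ge0// divr_ge0// !mulr_ge0// ltW.
have coef2 : E * eta ^+ 2 / 2 * (L1 * S) <= eta * (1 / 4 * S).
  rewrite [leLHS](_ : _ = eta * ((L1 * E * eta) / 2 * S)); last by field.
  apply: ler_wpM2l; first exact: ltW.
  apply: ler_wpM2r => //.
  have : L1 * E * eta <= L1 * E * rad by rewrite ler_wpM2l// mulr_ge0// ltW.
  lra.
have e1 : eta * Ep <= eta * (u 0%N / a + (eta / a) ^+ 2 * (n * c0) + V + 2 / 27 * S).
  apply: ler_wpM2l; first exact: ltW.
  move: Ule coef1 epssum; rewrite mulrDr; move: (_ ^+ 2 * _) (_ ^+ 2 * _) => p q; lra.
have etaS : 0 <= eta * S by rewrite mulr_ge0// ltW.
move: tele e1 coef2 etaS fK; move: (phi K.+1) (phi 0%N) (u 0%N / a) => f1 f0 ua.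
rewrite [n * (_ * c0)]mulrCA; move: (_ ^+ 2 * (n * c0)) => p.
clearbody S V Ep n => *; lra.
Qed.

(* The part of the momentum error that is due to the sampling noise n. *)
Fixpoint noise_average {R : realType} {d : nat} (a : R) (n : nat -> 'rV[R]_d)
    (k : nat) : 'rV[R]_d :=
  if k is j.+1 then (1 - a) *: noise_average a n j + a *: n j.+1 else 0.

Section Trajectory.
Context {R : realType} {d : nat} (d_gt0 : (0 < d)%N).
Context {N : 'rV[R]_d -> R} (N_norm : is_norm N).
Context {rho_lo rho_hi : R} (rho_lo_gt0 : 0 < rho_lo) (rho_hi_gt0 : 0 < rho_hi).
Context (rhoP : forall u : 'rV[R]_d,
  rho_lo * norm2 u <= dual_norm N u <= rho_hi * norm2 u).
Context {f : 'rV[R]_d -> R} (f_diff2 : twice_differentiable f).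
Context (A2 : has_lbound (range f)).
Context {L0 L1 : R} (L1_gt0 : 0 < L1) (A3 : symmetric_lipschitz_grad N f L0 L1).
Context {M0 M1 : R} (M1_gt0 : 0 < M1) (A4 : symmetric_lipschitz_hess N f M0 M1).
Context {a eta rad : R} (a_gt0 : 0 < a) (a_le1 : a <= 1) (eta_gt0 : 0 < eta).
Context (eta_rad : eta <= rad) (eta_a_rad : eta / a <= rad).
Context (L1_rad : L1 * rad <= 1 / 3) (M1_rad : M1 * rad ^+ 2 <= 1 / 9).
Context {K : nat} {x y m g : nat -> 'rV[R]_d} {lmo : nat -> 'rV[R]_d -> 'rV[R]_d}.
Context (lmo_ball : forall k, (k <= K)%N -> N (lmo k (m k)) <= eta).
Context (lmo_min : forall k v, (k <= K)%N -> N v <= eta ->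
  dot (m k) (lmo k (m k)) <= dot (m k) v).
Context (xS : forall k, (k <= K)%N -> x k.+1 = x k + lmo k (m k)).
Context (yS : forall k, (k <= K)%N ->
  y k.+1 = x k.+1 + ((1 - a) / a) *: (x k.+1 - x k)).
Context (mS : forall k, (k <= K)%N ->
  m k.+1 = (1 - a) *: m k + a *: g k.+1).

Local Notation dualN := (dual_norm N).
Local Notation gnorm x := (dual_norm N (grad f x)).
Local Notation Gs x := (@gscale _ _ N f L0 L1 x).
Local Notation E := (expR (L1 * rad)).
Local Notation noise := (fun k => g k - grad f (y k)).
Local Notation V := (noise_average a noise).
Local Notation e k := (m k - grad f (x k)).
Local Notation W x := (M0 / 2 + M1 * (gnorm x / 2 + Gs x * E * rad / 3)).

Let rad_gt0 : 0 < rad. Proof. exact: lt_le_trans eta_rad. Qed.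

Let L0_ge0 : 0 <= L0.
Proof.
exact: (grad_lipschitz_const_ge0 d_gt0 N_norm rho_lo_gt0 rho_hi_gt0 rhoP f_diff2
  L1_gt0 A3 A2).
Qed.

Let M0_ge0 : 0 <= M0.
Proof.
exact: (hess_lipschitz_const_ge0 d_gt0 N_norm rho_lo_gt0 rho_hi_gt0 rhoP f_diff2
  L1_gt0 A3 A2 M1_gt0 A4).
Qed.

Let gnorm_ge0 z : 0 <= gnorm z.
Proof. exact: (dual_norm_ge0 N_norm rho_lo_gt0 rhoP). Qed.

Let Gs_ge0 z : 0 <= Gs z.
Proof. exact: (gscale_ge0 d_gt0 N_norm rho_lo_gt0 rho_hi_gt0 rhoP f_diff2 L1_gt0 A3). Qed.

Let W_ge0 z : 0 <= W z.
Proof.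
apply: addr_ge0; first by rewrite divr_ge0.
apply: mulr_ge0; first exact: ltW.
apply: addr_ge0; first by rewrite divr_ge0.
by rewrite divr_ge0// !mulr_ge0// ?expR_ge0// ltW.
Qed.

(** Inverting [1 - z <= exp (- z)] at [z = L1 * rad <= 1 / 3] gives the bound. *)
Let E_le : E <= 3 / 2.
Proof.
have h := expR_ge1Dx (- (L1 * rad)); rewrite expRN in h.
have e0 := expR_gt0 (L1 * rad).
have h1 : 1 - L1 * rad <= E^-1 by [].
have h2 : E * (2 / 3) <= 1.
  rewrite -ler_pdivlMl// mulr1; apply: le_trans h1.
  by move: L1_rad; move: (L1 * rad) => z; lra.
by lra.
Qed.

(** [rad] is a common bound for the step length [eta] and the extrapolation length. Freezing it in
    the exponential and in the cubic term leaves a factor [W z] independent of [r]. *)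
Lemma grad_taylor_rad z z' r : N (z' - z) <= r -> r <= rad ->
  dualN (grad f z' - grad f z - (z' - z) *m hess f z) <= r ^+ 2 * W z.
Proof.
move=> zr rr; have r0 : 0 <= r by apply: le_trans zr; exact: is_norm_ge0.
have := grad_taylor d_gt0 N_norm rho_lo_gt0 rho_hi_gt0 rhoP f_diff2 L1_gt0 A3 M1_gt0 A4 z zr.
rewrite [z + _]addrC subrK => /le_trans; apply.
apply: ler_wpM2l; first exact: sqr_ge0.
rewrite lerD2l; apply: ler_wpM2l; first exact: ltW.
rewrite lerD2l ler_pM2r//; apply: ler_pM => //.
- by rewrite mulr_ge0 ?expR_ge0.
- apply: ler_wpM2l => //; rewrite ler_expR; apply: ler_wpM2l => //; exact: ltW.
Qed.

(* The extrapolation point y makes the first-order (Hessian) terms cancel: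
   (1 - a) (x_k - x_{k+1}) + a (y_{k+1} - x_{k+1}) = 0. *)
Lemma drift_step k : (k <= K)%N ->
  dualN (e k.+1 - V k.+1)
    <= (1 - a) * dualN (e k - V k) + eta ^+ 2 / a * W (x k.+1).
Proof.
move=> kK; set H := hess f (x k.+1).
have xk : N (x k - x k.+1) <= eta.
  by rewrite -(is_normN N_norm) opprB xS// addrC addKr lmo_ball.
pose r := (1 - a) / a * eta.
have a1 : 0 <= 1 - a by rewrite subr_ge0.
have c0 : 0 <= (1 - a) / a by rewrite divr_ge0// ltW.
have yk : N (y k.+1 - x k.+1) <= r.
  rewrite yS// [_ + _ *: _]addrC addrK (is_normZ N_norm) ger0_norm//.
  by apply: ler_wpM2l => //; rewrite -(is_normN N_norm) opprB.
have rrad : r <= rad.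
  apply: le_trans eta_a_rad; rewrite /r -mulrA [_^-1 * _]mulrC.
  by rewrite ler_piMl ?divr_ge0 ?(ltW eta_gt0) ?(ltW a_gt0)// gerBl ltW.
have Z1 := grad_taylor_rad xk eta_rad.
have Z2 := grad_taylor_rad yk rrad.
have eS : e k.+1 - V k.+1 = (1 - a) *: (e k - V k)
   + ((1 - a) *: (grad f (x k) - grad f (x k.+1) - (x k - x k.+1) *m H)
   + a *: (grad f (y k.+1) - grad f (x k.+1) - (y k.+1 - x k.+1) *m H)).
  have lin : (1 - a) *: (x k - x k.+1) + a *: (y k.+1 - x k.+1) = 0.
    by apply: extrapolation_cancel; [rewrite gt_eqF|exact: yS].
  have {lin} : (1 - a) *: ((x k - x k.+1) *m H) + a *: ((y k.+1 - x k.+1) *m H) = 0.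
    by rewrite 2!scalemxAl -mulmxDl lin mul0mx.
  move=> lin; rewrite mS// [V k.+1]/(_ + _).
  exact: momentum_error_split.
rewrite [leLHS](congr1 (dual_norm N) eS).
have normD := dual_normD N_norm rho_lo_gt0 rhoP.
have normZ := dual_normZ N_norm rho_lo_gt0 rhoP.
apply: (le_trans (normD _ _)); apply: lerD; first exact: normZ.
apply: (le_trans (normD _ _)).
apply: (le_trans (lerD (normZ _ _ a1) (normZ _ _ (ltW a_gt0)))).
apply: (le_trans (lerD (ler_wpM2l a1 Z1) (ler_wpM2l (ltW a_gt0) Z2))).
(* Both remainders carry the same [W], and [(1 - a) * eta^2 + a * r^2] equals
   [(1 - a) * eta^2 / a]. *)
rewrite !mulrA -mulrDl; apply: ler_wpM2r => //.
rewrite /r ler_pdivlMr// [leLHS](_ : _ = (1 - a) * eta ^+ 2); last by field; rewrite gt_eqF.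
by apply: ler_piMl; [exact: sqr_ge0|rewrite gerBl ltW].
Qed.

(** The error is paid twice, hence [2 * eta]: once for replacing the gradient by [m k] in the linear
    term, once for comparing their dual norms. *)
Lemma descent_step k : (k <= K)%N ->
  eta * gnorm (x k) <= f (x k) - f (x k.+1) + 2 * eta * dualN (e k)
    + Gs (x k) * E * eta ^+ 2 / 2.
Proof.
move=> kK; set v := lmo k (m k).
have vk : N v <= eta by exact: lmo_ball.
(* Minimality is tested against [- eta *: w] for every [w] in the unit ball. *)
have mv : eta * dualN (m k) <= - dot (m k) v.
  rewrite mulrC -ler_pdivlMr//; apply: (dual_norm_le N_norm rho_lo_gt0 rhoP) => w w1.
  rewrite ler_pdivlMr// mulrC -dotZr lerNr -dotNr; apply: lmo_min => //.
  by rewrite (is_normN N_norm) (is_normZ N_norm) gtr0_norm// ler_piMr// ltW.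
have ev : - dot (e k) v <= eta * dualN (e k).
  rewrite -dotNl; apply: (le_trans (dot_le_dual_norm N_norm rho_lo_gt0 rhoP _ _)).
  rewrite (dual_normN N_norm rho_lo_gt0 rhoP) mulrC; apply: ler_wpM2r => //.
  exact: (dual_norm_ge0 N_norm rho_lo_gt0 rhoP).
have gm : gnorm (x k) <= dualN (m k) + dualN (e k).
  rewrite -[X in dualN X <= _](subKr (m k)).
  apply: le_trans (dual_normD N_norm rho_lo_gt0 rhoP _ _) _.
  by rewrite (dual_normN N_norm rho_lo_gt0 rhoP).
have := descent d_gt0 N_norm rho_lo_gt0 rho_hi_gt0 rhoP f_diff2 L1_gt0 A3 (x k) vk.
rewrite -xS// => D.
have D2 : Gs (x k) * expR (L1 * eta) * eta ^+ 2 / 2 <= Gs (x k) * E * eta ^+ 2 / 2.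
  rewrite ler_pM2r//; apply: ler_wpM2r; first exact: sqr_ge0.
  by apply: ler_wpM2l => //; rewrite ler_expR ler_pM2l.
have dE : dot (grad f (x k)) v = dot (m k) v - dot (e k) v.
  by rewrite -dotNl -dotDl subKr.
move: D; rewrite dE => D.
have {}gm := ler_wpM2l (ltW eta_gt0) gm.
move: (f (x k.+1)) (f (x k)) (dot (m k) v) (dot (e k) v) (dualN (m k)) D D2 gm mv ev.
move: (Gs (x k) * expR (L1 * eta) * eta ^+ 2 / 2).
move: (Gs (x k) * E * eta ^+ 2 / 2) (dualN (e k)) (gnorm (x k)) => *; lra.
Qed.

Lemma trajectory_bound :
  eta * \sum_(k < K.+1) gnorm (x k) <= 2 * (f (x 0%N) - inf (range f))
    + 4 * eta * (\sum_(k < K.+1) dualN (V k) + dualN (e 0%N) / a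
        + K.+1%:R * ((eta / a) ^+ 2 * (M0 / 2 + M1 * L0 * E * rad / 3)))
    + K.+1%:R * (L0 * E * eta ^+ 2).
Proof.
(* The noise average starts at 0, so the drift starts from the whole initial error. *)
have -> : dualN (e 0%N) = dualN (e 0%N - V 0%N) by rewrite /= subr0.
have M1a : M1 * (eta / a) ^+ 2 <= 1 / 9.
  apply: le_trans M1_rad; apply: ler_wpM2l; first exact: ltW.
  by apply: lerXn2r eta_a_rad; rewrite nnegrE ?divr_ge0// ltW.
have epsE k : dualN (e k) <= dualN (e k - V k) + dualN (V k).
  rewrite -[X in dualN X <= _](subrK (V k)).
  exact: (dual_normD N_norm rho_lo_gt0 rhoP).
have finfP k : inf (range f) <= f (x k) by apply: ge_inf => //; exists (x k).
apply: (sum_gradient_bound (rad := rad) (L1 := L1) a_gt0 a_le1 eta_gt0 rad_gt0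
  L0_ge0 L1_gt0 M0_ge0 M1_gt0 (expR_ge0 _) E_le eta_rad L1_rad M1a
  (fun k => gnorm_ge0 (x k)) (u := fun k => dualN (e k - V k)) _ epsE finfP).
- by move=> k; exact: (dual_norm_ge0 N_norm rho_lo_gt0 rhoP).
- exact: drift_step.
- exact: descent_step.
Qed.

End Trajectory.

(** * Measurability of random vectors *)

Section VectorMeasurability.
Context {R : realType} {d : nat}.
Implicit Types v : 'rV[R]_d.

(** A countable family of boxes with rational centres; it reduces statements about open sets and
    continuous functions to countable unions and intersections. *)
Definition rat_box (c : 'rV[rat]_d) (n : nat) : set 'rV[R]_d :=
  [set v | forall i, `|v 0 i - ratr (c 0 i)| < n.+1%:R^-1].

Lemma rat_box_small v n : exists c, rat_box c n v.
Proof.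
have q i : exists q : rat, `|v 0 i - ratr q| < n.+1%:R^-1.
  have lt : v 0 i - n.+1%:R^-1 < v 0 i + n.+1%:R^-1 by rewrite ltrD2l gtrN.
  have [q] := rat_in_itvoo lt; rewrite in_itv/= => qlt; exists q.
  by rewrite distrC ltr_distl.
have [c hc] := choice q.
by exists (\row_i c i) => i; rewrite mxE.
Qed.

Lemma exists_invn_lt (e : R) : 0 < e -> exists n : nat, n.+1%:R^-1 < e.
Proof.
move=> e0; exists (Num.bound e^-1).
rewrite invf_plt ?posrE//; apply: lt_trans (archi_boundP _) _; rewrite ?invr_ge0 ?ltW//.
by rewrite ltr_nat.
Qed.

Lemma nbhs_coord v (A : set 'rV[R]_d) : nbhs v A ->
  exists2 e : R, 0 < e & forall v', (forall i, `|v 0 i - v' 0 i| < e) -> A v'.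
Proof.
move=> /nbhs_ballP[e /= e0 eA]; exists e => // v' hv; apply: eA.
by split => // i j; rewrite (ord1 i); exact: hv.
Qed.

Lemma measurable_forall {disp} {T : measurableType disp} {U : countType}
    (F : U -> set T) :
  (forall u, measurable (F u)) -> measurable [set w | forall u, F u w].
Proof.
move=> mF; rewrite [X in measurable X](_ : _ = ~` (\bigcup_u ~` F u)).
  apply/measurableC/countable_bigcupT_measurable => [|u]; last exact: measurableC.
  exact: countableP.
rewrite setC_bigcup predeqE => w; split => [h u _|h u]; first by rewrite setCK.
by have := h u I; rewrite setCK.
Qed.

Lemma measurable_rat_box {disp} {T : measurableType disp} (X : T -> 'rV[R]_d) c n :
  (forall i, measurable_fun setT (fun w => X w 0 i)) ->
  measurable [set w | rat_box c n (X w)].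
Proof.
move=> mX; apply: measurable_forall => i.
have mXi : measurable_fun setT (fun w => `|X w 0 i - ratr (c 0 i)|).
  by apply: measurableT_comp => //; apply: measurable_funB => //; exact: measurable_cst.
rewrite [X in measurable X](_ : _ = setT `&`
   (fun w => `|X w 0 i - ratr (c 0 i)|) @^-1` `]-oo, n.+1%:R^-1[%classic).
  by apply: mXi => //; exact: measurable_itv.
by rewrite setTI; apply/seteqP; split => w /=; rewrite in_itv.
Qed.

(** [measurable_rV] refers to open sets while the method is computed by coordinates; an open set is
    the union of the countably many rational boxes that it contains. *)
Lemma measurable_rVP {disp} {T : measurableType disp} (X : T -> 'rV[R]_d) :
  measurable_rV X <-> forall i, measurable_fun setT (fun w => X w 0 i).
Proof.
split=> [mX i|mX].
  have mc : measurable_fun setT ((fun v : 'rV[R]_d => v 0 i) : borel_rV R d -> R).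
    move=> mD; apply: (measurability _ (RGenOpens.measurableE R)) => //.
    move=> _ [_ [a [b ->] <-]]; rewrite setTI; apply: sub_sigma_algebra.
    have /continuousP := @coord_continuous R 1 d 0 i; apply.
    exact: interval_open.
  exact: (measurableT_comp mc mX).
move=> mD; apply: (@measurability _ _ _ (borel_rV R d) setT X open erefl) => //.
move=> _ [U oU <-]; rewrite setTI.
pose good := [set p : 'rV[rat]_d * nat | rat_box p.1 p.2 `<=` U].
rewrite [X in measurable X](_ : _ =
  \bigcup_(p in good) [set w | rat_box p.1 p.2 (X w)]).
  rewrite bigcup_mkcond; apply: countable_bigcupT_measurable; first exact: countableP.
  by move=> p; case: ifP => // _; exact: measurable_rat_box.
apply/seteqP; split => [w /= Uw|w [[c n] /= sub hw]]; last exact: sub.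
have /nbhs_coord[e e0 eU] : nbhs (X w) U by exact: open_nbhs_nbhs.
have e2 : 0 < e / 2 by rewrite divr_gt0.
have [n hn] := exists_invn_lt e2.
have [c hc] := rat_box_small (X w) n.
exists (c, n) => //= v hv; apply: eU => i.
rewrite [e]splitr; apply: le_lt_trans (ler_distD (ratr (c 0 i)) _ _) _.
by rewrite [X in _ + X]distrC ltrD// (lt_trans _ hn)// (hc, hv).
Qed.

Lemma continuous_borel_measurable (g : 'rV[R]_d -> R) : continuous g ->
  measurable_fun setT (g : borel_rV R d -> R).
Proof.
move=> cg mD; apply: (measurability _ (RGenOpens.measurableE R)) => //.
move=> _ [_ [a [b ->] <-]]; rewrite setTI; apply: sub_sigma_algebra.
by move/continuousP : cg; apply; exact: interval_open.
Qed.

(** The assumptions give measurability of the stochastic gradient at each fixed point, whereas the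
    method evaluates it at a random one; continuity in the point bridges the gap. *)
Lemma measurable_caratheodory {dS dT} {S : measurableType dS} {T : measurableType dT}
    (h : S -> 'rV[R]_d -> R) (s : T -> S) (y : T -> 'rV[R]_d) :
  (forall v, measurable_fun setT (fun z => h z v)) -> (forall z, continuous (h z)) ->
  measurable_fun setT s -> measurable_rV y ->
  measurable_fun setT (fun w => h (s w) (y w)).
Proof.
move=> mh ch ms /measurable_rVP my mD.
apply: (measurability _ (RGenInftyO.measurableE R)) => //.
move=> _ [_ [b ->] <-]; rewrite setTI.
(* The event [h (s w) (y w) < b] says that, for some margin 1/(k+1) and some box size, every
   rational centre whose box contains [y w] has value at most [b - 1/(k+1)]. *)
pose F (p : nat * nat) (c : 'rV[rat]_d) : set T :=
  (~` [set w | rat_box c p.1 (y w)]) `|`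
  [set w | h (s w) (map_mx ratr c) <= b - p.2.+1%:R^-1].
have mF p c : measurable (F p c).
  apply: measurableU; first exact/measurableC/measurable_rat_box.
  rewrite [X in measurable X](_ : _ = setT `&` s @^-1`
    (setT `&` (fun z => h z (map_mx ratr c)) @^-1` `]-oo, b - p.2.+1%:R^-1]%classic)).
    by apply: ms => //; apply: mh => //; exact: measurable_itv.
  by rewrite !setTI; apply/seteqP; split => w /=; rewrite in_itv.
rewrite [X in measurable X](_ : _ = \bigcup_p [set w | forall c, F p c w]).
  apply: countable_bigcupT_measurable => [|p]; first exact: countableP.
  exact: measurable_forall.
apply/seteqP; split => [w /=|w [[n k] _ /= hF]]; rewrite in_itv/=.
  move=> hb; have gap : 0 < b - h (s w) (y w) by rewrite subr_gt0.
  have [k hk] := exists_invn_lt gap.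
  have hk' : h (s w) (y w) < b - k.+1%:R^-1 by rewrite ltrBrDl -ltrBrDr.
  have [e e0 he] := nbhs_coord (cvgr_lt _ (ch (s w) (y w)) _ hk').
  have [n hn] := exists_invn_lt e0.
  exists (n, k) => // c; rewrite /F/=.
  have [cn|] := pselect (rat_box c n (y w)); [right|by left].
  by apply/ltW/he => i; rewrite mxE (lt_trans _ hn)//; exact: cn.
rewrite ltNge; apply/negP => hb.
have hb' : b - k.+1%:R^-1 < h (s w) (y w).
  by apply: lt_le_trans hb; rewrite ltrBlDr ltrDl.
have [e e0 he] := nbhs_coord (cvgr_gt _ (ch (s w) (y w)) _ hb').
have [n' hn'] := exists_invn_lt e0.
(* The centre must satisfy the premise of [hF] (size [n]) and lie within [e] of [y w] (size
   [n']). *)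
have [c hc] := rat_box_small (y w) (maxn n n').
have /he : forall i, `|y w 0 i - map_mx ratr c 0 i| < e.
  move=> i; rewrite mxE; apply: lt_trans (hc i) _; apply: le_lt_trans hn'.
  by rewrite lef_pV2 ?posrE// ler_nat ltnS leq_maxr.
have [|] := hF c; last by move=> /= h1 /(le_lt_trans h1); rewrite ltxx.
case=> i; apply: lt_le_trans (hc i) _.
by rewrite lef_pV2 ?posrE// ler_nat ltnS leq_maxl.
Qed.

Lemma measurable_dot {disp} {T : measurableType disp} (X Y : T -> 'rV[R]_d) :
  measurable_rV X -> measurable_rV Y ->
  measurable_fun setT (fun w => dot (X w) (Y w)).
Proof.
move=> /measurable_rVP mX /measurable_rVP mY; apply: measurable_sum => i.
exact: measurable_funM.
Qed.

Lemma measurable_rV_lin {disp} {T : measurableType disp} (a b : R)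
    (X Y : T -> 'rV[R]_d) : measurable_rV X -> measurable_rV Y ->
  measurable_rV (fun w => a *: X w + b *: Y w).
Proof.
move=> /measurable_rVP mX /measurable_rVP mY; apply/measurable_rVP => i.
under eq_fun do rewrite !mxE.
by apply: measurable_funD; apply: measurable_funM => //; exact: measurable_cst.
Qed.

End VectorMeasurability.

(** * Independence *)

Section IndependentPair.
Local Open Scope ereal_scope.
Context {R : realType} {dT dU dS : measure_display}.
Context {T : measurableType dT} {U : measurableType dU} {S : measurableType dS}.
Context {P : probability T R} {D : probability S R}.

(** The hypothesis on rectangles encodes both the independence and the law of [X]: the joint law is
    a product, and Tonelli applies to the nonnegative integrand. *)
Lemma integral_independent_pair (phi : {mfun T >-> U}) (X : {mfun T >-> S})
    (F : U * S -> \bar R) :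
  (forall A B, measurable A -> measurable B ->
     P (phi @^-1` A `&` X @^-1` B) = P (phi @^-1` A) * D B) ->
  measurable_fun setT F -> (forall z, 0 <= F z) ->
  \int[P]_w F (phi w, X w) = \int[P]_w \int[D]_s F (phi w, s).
Proof.
move=> indep mF F0.
have mpair : measurable_fun setT (fun w => (phi w, X w)).
  by apply: measurable_fun_pair.
pose pair : {mfun T >-> (U * S)%type} := mfun_Sub (mem_set mpair).
have jointE A : measurable A -> (distribution P phi \x D) A = distribution P pair A.
  apply: product_measure_unique => A' B mA mB.
  by rewrite /= /distribution /pushforward -indep.
transitivity (\int[distribution P pair]_z F z).
  by rewrite ge0_integral_distribution.
transitivity (\int[distribution P phi \x D]_z F z).
  by apply: eq_measure_integral => A mA _; exact: (esym (jointE A mA)).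
rewrite fubini_tonelli1// ge0_integral_distribution//.
  exact: measurable_fun_fubini_tonelli_F.
by move=> u; apply: integral_ge0.
Qed.

End IndependentPair.

Section Cylinders.
Context {R : realType} {disp : measure_display} {T : measurableType disp}.
Context {P : probability T R} {I : choiceType} {G : I -> set (set T)}.
Implicit Type J : {fset I}.

(** A pi-system generating the joint sigma-algebra of the family over [J]; intersecting over all of
    [J], with [setT] as filler, makes stability under intersection immediate. *)
Definition cylinders J : set (set T) :=
  [set \bigcap_(i in [set` J]) A i | A in [set A | forall i, G i (A i)]].

Context (G_setT : forall i, G i setT) (G_setI : forall i, setI_closed (G i)).
Context (G_meas : forall i, G i `<=` measurable).

Lemma cylinders_setI J : setI_closed (cylinders J).
Proof.
move=> _ _ [A GA <-] [B GB <-]; exists (fun i => A i `&` B i).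
  by move=> i; exact: G_setI.
by rewrite bigcapI.
Qed.

Lemma sub_cylinders J i : i \in J -> G i `<=` cylinders J.
Proof.
move=> iJ B GB; exists (fun k => if k == i then B else setT).
  by move=> k; case: eqP => [->|].
apply/seteqP; split => [w /(_ i iJ)|w Bw k _]; first by rewrite /= eqxx.
by case: ifP.
Qed.

Lemma cylinders_measurable J : cylinders J `<=` measurable.
Proof.
move=> _ [A GA <-]; apply: fin_bigcap_measurable => //.
by move=> i _; exact/G_meas/GA.
Qed.

Lemma sigma_cylinders_measurable J : <<s cylinders J >> `<=` measurable.
Proof.
apply: smallest_sub; first exact: sigma_algebra_measurable.
exact: cylinders_measurable.
Qed.

(** For fixed [C], the finite measures [P (B & C)] and [P C * P B] of [B] agree on the cylinders by
    mutual independence over [J] and [i], hence on the sigma-algebra they generate. *)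
Lemma sigma_cylinders_independent J i B C : mutually_independent P G ->
  i \notin J -> <<s cylinders J >> B -> G i C ->
  P (B `&` C) = (P B * P C)%E.
Proof.
move=> indep iJ sB GC; have mC := G_meas GC.
have fC : P C \is a fin_num by exact: fin_num_measure.
pose c : {nonneg R} := NngNum (fine_ge0 (measure_ge0 P C)).
have cE : c%:num%:E = P C by rewrite /= fineK.
suff : mrestr P mC B = mscale c P B by rewrite /mscale /mrestr cE muleC.
apply: (@g_sigma_algebra_measure_unique _ _ _ (cylinders J) _ (fun _ => setT)) => //.
- exact: cylinders_measurable.
- by move=> _; exists (fun=> setT) => //; apply/seteqP; split.
- by rewrite bigcup_const//; exists 0%N.
- exact: cylinders_setI.
- move=> _ [A GA <-].
  have := indep (i |` J)%fset (fun k => if k == i then C else A k).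
  rewrite big_fsetU1//= eqxx => h.
  have JE : forall k, k \in J -> (if k == i then C else A k) = A k.
    by move=> k kJ; case: eqP => // ki; rewrite ki (negbTE iJ) in kJ.
  rewrite /mrestr /mscale cE.
  have -> : (\bigcap_(k in [set` J]) A k) `&` C =
    \bigcap_(k in [set` (i |` J)%fset]) (if k == i then C else A k).
    apply/seteqP; split => [w [hA hC] k|w hw].
      rewrite /= in_fset1U => /orP[/eqP->|kJ]; first by rewrite eqxx.
      by rewrite JE//; exact: hA.
    split; last by have := hw i; rewrite /= fset1U1 eqxx; exact.
    by move=> k kJ; have := hw k; rewrite JE//; apply; rewrite /= in_fset1U kJ orbT.
  rewrite h; last by move=> k _; case: eqP => [->|].
  congr (_ * _)%E; transitivity (\prod_(k <- J) P (A k))%E.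
    by apply: eq_big_seq => k kJ; rewrite JE.
  by apply/esym/indep => k _; exact: GA.
- by move=> _; rewrite /= /mrestr setTI ltey_eq fC.
Qed.

End Cylinders.

(** * Moment inequalities for centred noise *)

Section SecondMoments.
Context {R : realType} {disp : measure_display} {S : measurableType disp}.
Context (P : probability S R).

Lemma integral_sqr_norm_affine {d : nat} (n : S -> 'rV[R]_d) (v : 'rV[R]_d)
    (a b sigma : R) :
  (forall i, P.-integrable setT (fun s => (n s 0 i)%:E) /\
     (\int[P]_s (n s 0 i)%:E = 0)%E) ->
  (\int[P]_s (dot (n s) (n s))%:E <= (sigma ^+ 2)%:E)%E ->
  (\int[P]_s (dot (b *: v + a *: n s) (b *: v + a *: n s))%:E
     <= (b ^+ 2 * dot v v + a ^+ 2 * sigma ^+ 2)%:E)%E.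
Proof.
move=> n0 nsq.
have mn i : measurable_fun setT (fun s => n s 0 i).
  by have [/measurable_int/measurable_EFinP] := n0 i.
have mdot : measurable_fun setT (fun s => dot (n s) (n s)).
  by apply: measurable_sum => i; exact: measurable_funM.
have isq : P.-integrable setT (fun s => (dot (n s) (n s))%:E).
  apply/integrableP; split; first exact/measurable_EFinP.
  under eq_integral do rewrite gee0_abs ?lee_fin ?dotxx_ge0//.
  by apply: le_lt_trans nsq _; rewrite ltry.
have ilin i : P.-integrable setT (fun s => ((2 * a * b * v 0 i)%:E * (n s 0 i)%:E)%E).
  by apply: integrableZl => //; have [] := n0 i.
have icst : P.-integrable setT (fun s => (b ^+ 2 * dot v v)%:E).
  exact: (finite_measure_integrable_cst P).
have ilins := integrable_sum measurableT (index_enum 'I_d) (P := xpredT) (fun i _ => ilin i).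
have isqZ := integrableZl measurableT (a ^+ 2) isq.
rewrite (eq_integral (fun s => ((b ^+ 2 * dot v v)%:E +
   \sum_(i < d) ((2 * a * b * v 0 i)%:E * (n s 0 i)%:E)
   + (a ^+ 2)%:E * (dot (n s) (n s))%:E)%E)); last first.
  move=> s _; under [X in (_ + X + _)%E]eq_bigr do rewrite -EFinM.
  rewrite sumEFin -EFinM -!EFinD; congr (_%:E).
  rewrite dotDl !dotDr !dotZl !dotZr (dotC (n s) v).
  have -> : \sum_i 2 * a * b * v 0 i * n s 0 i = 2 * a * b * dot v (n s).
    by rewrite mulr_sumr; apply: eq_bigr => i _; rewrite mulrA.
  by ring.
rewrite integralD//; last exact: integrableD.
rewrite integralD// integral_sum// big1 ?adde0; last first.
  by move=> i _; have [ni ni0] := n0 i; rewrite integralZl// ni0 mule0.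
rewrite integralZl// integral_cst// [X in (_ * X + _)%E](probability_setT P) mule1.
rewrite EFinD leeD2l//.
by rewrite [leRHS]EFinM; apply: lee_wpmul2l; rewrite ?lee_fin ?sqr_ge0.
Qed.

Lemma centered_integral (g : S -> R) (c : R) :
  P.-integrable setT (EFin \o g) -> (\int[P]_s (g s)%:E = c%:E)%E ->
  P.-integrable setT (fun s => (g s - c)%:E) /\ (\int[P]_s (g s - c)%:E = 0)%E.
Proof.
move=> gi gE; have ci : P.-integrable setT (EFin \o cst c).
  exact: finite_measure_integrable_cst.
split; first exact: (integrableB measurableT gi ci).
under eq_integral do rewrite EFinB.
rewrite (integralB_EFin measurableT gi ci) gE.
rewrite [X in (_ - X)%E](integral_cst P measurableT c%:E).
by rewrite [X in (_ - _ * X)%E](probability_setT P) mule1 subee.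
Qed.

(** The pointwise bound of [X] by [X^2 / (2 (c + e)) + (c + e) / 2] is integrated; the positive [e]
    covers the case [c = 0]. *)
Lemma integral_le_of_sqr (X : S -> R) (c : R) : 0 <= c ->
  measurable_fun setT X -> (forall s, 0 <= X s) ->
  (\int[P]_s (X s ^+ 2)%:E <= (c ^+ 2)%:E)%E -> (\int[P]_s (X s)%:E <= c%:E)%E.
Proof.
move=> c0 mX X0 Xsq; apply/lee_addgt0Pr => e e0.
have ce : 0 < c + e by rewrite ltr_wpDl.
have mX2 : measurable_fun setT (fun s => X s ^+ 2) by exact: measurable_funX.
apply: (@le_trans _ _ (\int[P]_s ((2 * (c + e))^-1%:E * (X s ^+ 2)%:E + ((c + e) / 2)%:E))%E).
  apply: ge0_le_integral => //.
  - by move=> s _; rewrite lee_fin.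
  - exact/measurable_EFinP.
  - apply/measurable_EFinP; apply: measurable_funD => //.
    by apply: measurable_funM => //.
  move=> s _; rewrite -EFinM -EFinD lee_fin.
  (* AM-GM *)
  rewrite -subr_ge0 [leRHS](_ : _ = (X s - (c + e)) ^+ 2 / (2 * (c + e))); last first.
    by field; rewrite gt_eqF.
  by rewrite divr_ge0 ?sqr_ge0// mulr_ge0// ltW.
have k0 : (0 <= (2 * (c + e))^-1%:E)%E by rewrite lee_fin invr_ge0 mulr_ge0// ltW.
have Xsq0 s : setT s -> (0 <= (X s ^+ 2)%:E)%E by move=> _; rewrite lee_fin sqr_ge0.
have mXE : measurable_fun setT (fun s => (X s ^+ 2)%:E) by exact/measurable_EFinP.
rewrite (ge0_integralD P measurableT); first last.
- exact: measurable_cst.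
- by move=> s _; rewrite lee_fin divr_ge0// ltW.
- exact: measurable_funeM.
- by move=> s _; rewrite mule_ge0// Xsq0.
rewrite (ge0_integralZl P measurableT)//.
rewrite integral_cst// [X in (_ + _ * X)%E](probability_setT P) mule1.
apply: (@le_trans _ _ ((2 * (c + e))^-1%:E * (c ^+ 2)%:E + ((c + e) / 2)%:E)%E).
  by rewrite leeD2r// lee_wpmul2l// lee_fin invr_ge0 mulr_ge0// ltW.
rewrite -EFinM -!EFinD lee_fin -lerBrDr mulrC ler_pdivrMr ?mulr_gt0//.
nra.
Qed.

End SecondMoments.

(** * Noise along the method *)

Section StochasticProcess.
Context {R : realType} {d : nat} {dS dT : measure_display}.
Context {S : measurableType dS} {D : probability S R}.
Context {T : measurableType dT} {P : probability T R}.
Context {F : S -> 'rV[R]_d -> R} {f : 'rV[R]_d -> R}.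
Context (F_diff2 : forall s, twice_differentiable (F s)).
Context (f_diff2 : twice_differentiable f).
Context {sigma : R} (sigma_ge0 : 0 <= sigma).
Context (grad_mean : forall x (i : 'I_d),
  D.-integrable setT (fun s => (grad (F s) x 0 i)%:E) /\
  ('E_D[fun s => (grad (F s) x 0 i)%R] = (grad f x 0 i)%:E)%E).
Context (grad_var : forall x,
  ('E_D[fun s => (norm2 (grad (F s) x - grad f x) ^+ 2)%R] <= (sigma ^+ 2)%:E)%E).
Context {a : R} (a_ge0 : 0 <= a) (a_le1 : a <= 1).
Context {K : nat} {xi : nat -> {mfun T >-> S}} {m0 : T -> 'rV[R]_d}.
Context (m0_meas : measurable_rV m0).
Context (xi_law : forall k (A : set S), measurable A ->
  distribution P (xi k.+1) A = D A).
Context (xi_indep : mutually_independent P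
  (initial_and_sample_events m0 (fun k => xi k : T -> S))).
Context {x0 : 'rV[R]_d} {lmo : nat -> 'rV[R]_d -> 'rV[R]_d}.
Context (lmo_meas : forall k, (k <= K)%N ->
  measurable_rV (lmo k : borel_rV R d -> 'rV[R]_d)).
Context {x y m : nat -> T -> 'rV[R]_d}.
Context (method : lmo_extrapolated_momentum F (fun k => xi k : T -> S) lmo
  (fun=> a) K x0 m0 x y m).

Definition sample_noise (w : T) (k : nat) : 'rV[R]_d :=
  grad (F (xi k w)) (y k w) - grad f (y k w).

Local Notation V k w := (noise_average a (sample_noise w) k).

Lemma measurable_stochastic_grad {dU} {U : measurableType dU} (s : U -> S)
    (z : U -> 'rV[R]_d) : measurable_fun setT s -> measurable_rV z ->
  measurable_rV (fun u => grad (F (s u)) (z u)).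
Proof.
move=> ms mz; apply/measurable_rVP => i.
apply: (measurable_caratheodory (h := fun s z => grad (F s) z 0 i)) => // [v|s'].
  by have [/measurable_int/measurable_EFinP] := grad_mean v i.
move=> v; apply: (@continuous_comp _ _ _ (grad (F s')) (fun g : 'rV[R]_d => g 0 i)).
  exact: (grad_continuous (F_diff2 s')).
exact: coord_continuous.
Qed.

Lemma measurable_comp_borel {dU} {U : measurableType dU}
    (h : 'rV[R]_d -> 'rV[R]_d) (z : U -> 'rV[R]_d) :
  measurable_rV (h : borel_rV R d -> 'rV[R]_d) -> measurable_rV z ->
  measurable_rV (fun u => h (z u)).
Proof. by move=> mh mz; exact: (measurableT_comp mh mz). Qed.

Lemma measurable_comp_continuous {dU} {U : measurableType dU}
    (h : 'rV[R]_d -> R) (z : U -> 'rV[R]_d) :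
  continuous h -> measurable_rV z -> measurable_fun setT (fun u => h (z u)).
Proof. by move=> /continuous_borel_measurable mh mz; exact: (measurableT_comp mh mz). Qed.

Lemma measurable_grad {dU} {U : measurableType dU} (z : U -> 'rV[R]_d) :
  measurable_rV z -> measurable_rV (fun u => grad f (z u)).
Proof.
move=> mz; apply/measurable_rVP => i.
apply: (measurable_comp_continuous (h := fun v => grad f v 0 i)) mz.
move=> v; apply: (@continuous_comp _ _ _ (grad f) (fun g : 'rV[R]_d => g 0 i)).
  exact: (grad_continuous f_diff2).
exact: coord_continuous.
Qed.

Lemma measurable_rVB {dU} {U : measurableType dU} (z z' : U -> 'rV[R]_d) :
  measurable_rV z -> measurable_rV z' -> measurable_rV (fun u => z u - z' u).
Proof.
move=> mz mz'; have := measurable_rV_lin 1 (-1) mz mz'.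
by under eq_fun do rewrite scale1r scaleN1r.
Qed.

(** The point [y k.+1] is determined before the sample [xi k.+1] is drawn. The map [phi] lets the
    same statement serve for the ambient sigma-algebra and for that of the past. *)
Lemma measurable_next_points {dU} {U : measurableType dU} (phi : U -> T) (k : nat) :
  (k <= K)%N -> measurable_rV (fun u => x k (phi u)) ->
  measurable_rV (fun u => m k (phi u)) ->
  measurable_rV (fun u => x k.+1 (phi u)) /\ measurable_rV (fun u => y k.+1 (phi u)).
Proof.
move=> kK mx mm; have [_ _ stepE] := method.
have mx' : measurable_rV (fun u => x k.+1 (phi u)).
  rewrite (_ : (fun u => _) = fun u => 1 *: x k (phi u) + 1 *: lmo k (m k (phi u))).
    by apply: measurable_rV_lin => //; exact: measurable_comp_borel (lmo_meas kK) mm.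
  by apply/funext => u; have [-> _ _] := stepE k (phi u) kK; rewrite !scale1r.
split=> //; set c := (1 - a) / a.
rewrite (_ : (fun u => _) = fun u => (1 + c) *: x k.+1 (phi u) + - c *: x k (phi u)).
  exact: measurable_rV_lin.
apply/funext => u; have [_ -> _] := stepE k (phi u) kK.
by rewrite scalerBr scalerDl scale1r scaleNr addrA.
Qed.

Lemma measurable_iterates {dU} {U : measurableType dU} (phi : U -> T) (k : nat) :
  (k <= K.+1)%N -> measurable_rV (fun u => m0 (phi u)) ->
  (forall j, (j < k)%N -> measurable_fun setT (fun u => xi j.+1 (phi u))) ->
  [/\ measurable_rV (fun u => x k (phi u)), measurable_rV (fun u => m k (phi u)) &
      measurable_rV (fun u => V k (phi u))].
Proof.
have [x0E m0E stepE] := method.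
move=> + mm0; elim: k => [|k IH] kK mxi.
  split; [under eq_fun do rewrite x0E|under eq_fun do rewrite m0E|] => //;
    by apply/measurable_rVP => i; exact: measurable_cst.
have [mx mm mV] := IH (ltnW kK) (fun j jk => mxi j (ltnW jk)).
have [mx' my'] := measurable_next_points kK mx mm.
have mg := measurable_stochastic_grad (mxi k (ltnSn k)) my'.
split=> //.
  rewrite (_ : (fun u => _) = fun u => (1 - a) *: m k (phi u)
      + a *: grad (F (xi k.+1 (phi u))) (y k.+1 (phi u))).
    exact: measurable_rV_lin.
  by apply/funext => u; have [_ _ ->] := stepE k (phi u) kK.
exact: (measurable_rV_lin _ _ mV (measurable_rVB mg (measurable_grad my'))).
Qed.

Lemma integral_sqr_noise_step (v z : 'rV[R]_d) (b : R) :
  (\int[D]_s (dot (b *: v + a *: (grad (F s) z - grad f z))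
                  (b *: v + a *: (grad (F s) z - grad f z)))%:E
     <= (b ^+ 2 * dot v v + a ^+ 2 * sigma ^+ 2)%:E)%E.
Proof.
apply: integral_sqr_norm_affine => [i|].
  have [gi gE] := grad_mean z i; rewrite unlock in gE.
  have eqn : (fun s => ((grad (F s) z - grad f z) 0 i)%:E)
      = (fun s => (grad (F s) z 0 i - grad f z 0 i)%:E).
    by apply/funext => s; congr (_%:E); rewrite [LHS]mxE [X in _ + X]mxE.
  have [ci cE] := centered_integral gi gE.
  by split; rewrite eqn; [exact: ci|exact: cE].
move: (grad_var z); rewrite unlock.
by under eq_integral do rewrite sqr_norm2.
Qed.

Local Notation G := (initial_and_sample_events m0 (fun k => xi k : T -> S)).
(** [Some i] stands for xi_(i+1), so [J k] covers m0 and xi_1, ..., xi_k, and [Some k] is the first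
    index outside it. *)
Local Notation J k := (seq_fset tt (None :: [seq Some i | i <- iota 0 k])).
Local Notation past k := (@cylinders _ T _ G (J k)).

Lemma events_setT o : G o setT.
Proof. by case: o => [k|]; exists setT => //; rewrite setTI preimage_setT. Qed.

Lemma events_setI o : setI_closed (G o).
Proof.
by case: o => [k|] _ _ [A mA <-] [B mB <-]; exists (A `&` B);
  rewrite ?setTI ?preimage_setI//; exact: measurableI.
Qed.

Lemma events_measurable o : G o `<=` measurable.
Proof.
case: o => [k|] _ [A mA <-]; first exact: measurable_funP.
exact: m0_meas.
Qed.

(** The bound is preserved by the recursion t -> (1 - a)^2 t + a^2 sigma^2, with a gap of a^2 (1 -
    a) sigma^2. *)
Lemma second_moment_noise (k : nat) : (k <= K)%N ->
  (\int[P]_w (dot (V k w) (V k w))%:E <= (a * sigma ^+ 2)%:E)%E.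
Proof.
elim: k => [_|k IH kK].
  rewrite integral0_eq => [|w _]; last by rewrite /= dot0l.
  by rewrite lee_fin mulr_ge0// sqr_ge0.
(* [U] is [T] with the sigma-algebra of the past and [phi] is the identity, so measurability on [U]
   means adaptedness. *)
pose U := g_sigma_algebraType (past k).
have sub_past := @sigma_cylinders_measurable _ T _ G events_measurable (J k).
have mid : measurable_fun setT (idfun : T -> U).
  by move=> _ A mA; rewrite setTI; exact: sub_past.
pose phi : {mfun T >-> U} := mfun_Sub (mem_set mid).
have mm0 : measurable_rV (m0 : U -> 'rV[R]_d).
  move=> _ A mA; apply: sub_sigma_algebra.
  apply: (sub_cylinders events_setT (i := None)); first by rewrite seq_fsetE mem_head.
  by exists A.
have mxi j : (j < k)%N -> measurable_fun setT (xi j.+1 : U -> S).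
  move=> jk _ A mA; apply: sub_sigma_algebra.
  apply: (sub_cylinders events_setT (i := Some j)); last by exists A.
  by rewrite seq_fsetE inE/= map_f// mem_iota.
have [mx mm mV] := measurable_iterates (leqW (ltnW kK)) mm0 mxi.
have [_ my] := measurable_next_points (ltnW kK) mx mm.
have indep A B : measurable A -> measurable B ->
    P (phi @^-1` A `&` xi k.+1 @^-1` B) = (P (phi @^-1` A) * D B)%E.
  move=> mA mB; rewrite -(xi_law k mB).
  apply: (sigma_cylinders_independent events_setT events_setI events_measurable xi_indep
    (J := J k) (i := Some k)) => //; last by exists B => //; rewrite setTI.
  rewrite seq_fsetE inE/=; apply/mapP => -[j + [jk]].
  by rewrite mem_iota/= add0n jk ltnn.
(* [V k.+1] as a function of the past and of a separate fresh sample, ready for the product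
   measure. *)
pose z (u : U * S) : 'rV[R]_d :=
  (1 - a) *: V k u.1 + a *: (grad (F u.2) (y k.+1 u.1) - grad f (y k.+1 u.1)).
have mfst : measurable_fun setT (fst : U * S -> U) by exact: measurable_fst.
have myz : measurable_rV (fun u : U * S => y k.+1 u.1).
  exact: (measurableT_comp my mfst).
have mz : measurable_rV z.
  have mVz : measurable_rV (fun u : U * S => V k u.1) by exact: (measurableT_comp mV mfst).
  have mgz := measurable_stochastic_grad (@measurable_snd _ _ U S) myz.
  exact: (measurable_rV_lin _ _ mVz (measurable_rVB mgz (measurable_grad myz))).
pose H (u : U * S) := (dot (z u) (z u))%:E.
have mH : measurable_fun setT H by exact/measurable_EFinP/measurable_dot.
have H0 u : (0 <= H u)%E by rewrite lee_fin dotxx_ge0.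
have step w : (\int[D]_s H (phi w, s) <= ((1 - a) ^+ 2)%:E * (dot (V k w) (V k w))%:E
    + (a ^+ 2 * sigma ^+ 2)%:E)%E.
  exact: integral_sqr_noise_step (V k w) (y k.+1 w) (1 - a).
have jointE := integral_independent_pair indep mH H0.
rewrite [leLHS](jointE : \int[P]_w (dot (V k.+1 w) (V k.+1 w))%:E = _)%E.
have mVT : measurable_fun setT (fun w => (dot (V k w) (V k w))%:E).
  apply/measurable_EFinP; exact: (measurableT_comp (measurable_dot mV mV) mid).
apply: (@le_trans _ _ (\int[P]_w (((1 - a) ^+ 2)%:E * (dot (V k w) (V k w))%:E
   + (a ^+ 2 * sigma ^+ 2)%:E))%E).
  apply: ge0_le_integral => //.
  - by move=> w _; apply: integral_ge0 => s _; exact: H0.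
  - have mHU : measurable_fun setT (fun u : U => \int[D]_s H (u, s))%E.
      exact: measurable_fun_fubini_tonelli_F.
    exact: (measurableT_comp mHU mid).
  - apply: emeasurable_funD; last exact: measurable_cst.
    exact: measurable_funeM.
have c0 : (0 <= ((1 - a) ^+ 2)%:E)%E by rewrite lee_fin sqr_ge0.
have V0 w : setT w -> (0 <= (dot (V k w) (V k w))%:E)%E by rewrite lee_fin dotxx_ge0.
rewrite (ge0_integralD P measurableT); first last.
- exact: measurable_cst.
- by move=> w _; rewrite lee_fin mulr_ge0// sqr_ge0.
- exact: measurable_funeM.
- by move=> w _; rewrite mule_ge0// V0.
rewrite (ge0_integralZl P measurableT)// integral_cst//.
rewrite [X in (_ + _ * X)%E](probability_setT P) mule1.
apply: (@le_trans _ _ (((1 - a) ^+ 2)%:E * (a * sigma ^+ 2)%:E + (a ^+ 2 * sigma ^+ 2)%:E)%E).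
  by rewrite leeD2r// lee_wpmul2l// IH// ltnW.
rewrite -EFinM -EFinD lee_fin mulrA -mulrDl; apply: ler_wpM2r; first exact: sqr_ge0.
rewrite -subr_ge0 [leRHS](_ : _ = a ^+ 2 * (1 - a)); last by ring.
by rewrite mulr_ge0 ?sqr_ge0// subr_ge0.
Qed.

End StochasticProcess.

(** * Averaging over the iterations and final rates *)

Lemma bigmine_le_average {R : realType} {disp : measure_display}
    {T : measurableType disp} (P : probability T R) (n : nat)
    (g v : nat -> T -> R) (e : T -> R) (A b c r : R) :
  (0 < n)%N -> 0 <= A -> 0 <= b -> 0 <= c ->
  (forall k, (k < n)%N -> measurable_fun setT (g k)) -> (forall k w, 0 <= g k w) ->
  (forall k, (k < n)%N -> measurable_fun setT (v k)) -> (forall k w, 0 <= v k w) ->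
  measurable_fun setT e -> (forall w, 0 <= e w) ->
  (forall k, (k < n)%N -> (\int[P]_w (v k w)%:E <= r%:E)%E) ->
  (forall w, \sum_(k < n) g k w <= n%:R * A + b * \sum_(k < n) v k w + n%:R * c * e w) ->
  (\big[mine/+oo]_(k < n) \int[P]_w (g k w)%:E
    <= A%:E + (b * r)%:E + c%:E * \int[P]_w (e w)%:E)%E.
Proof.
move=> n0 A0 b0 c0 mg g0 mv v0 me e0 vr le_gve.
set mu := (\big[mine/+oo]_(k < n) _)%E.
have n0R : 0 < n%:R :> R by rewrite ltr0n.
have mule k : (mu <= \int[P]_w (g (k : 'I_n) w)%:E)%E by exact: bigmin_le.
have sum_mu : (n%:R%:E * mu <= \int[P]_w (\sum_(k < n) g k w)%:E)%E.
  under eq_integral do rewrite -sumEFin.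
  rewrite ge0_integral_sum//; last 2 first.
  - by move=> k; exact/measurable_EFinP/mg.
  - by move=> k w _; rewrite lee_fin.
  have -> : (n%:R%:E * mu = \sum_(k < n) mu)%E.
    by rewrite sumr_const card_ord mule_natl.
  by apply: lee_sum => k _.
have mgs : measurable_fun setT (fun w => \sum_(k < n) g k w).
  by apply: measurable_sum => k; exact: mg.
have mvs : measurable_fun setT (fun w => \sum_(k < n) v k w).
  by apply: measurable_sum => k; exact: mv.
have vs0 w : 0 <= \sum_(k < n) v k w by exact: sumr_ge0.
have Evs : (\int[P]_w (\sum_(k < n) v k w)%:E <= (n%:R * r)%:E)%E.
  under eq_integral do rewrite -sumEFin.
  rewrite ge0_integral_sum//; last 2 first.
  - by move=> k; exact/measurable_EFinP/mv.
  - by move=> k w _; rewrite lee_fin.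
  apply: (@le_trans _ _ (\sum_(k < n) r%:E)%E); first by apply: lee_sum => k _; exact: vr.
  by rewrite sumEFin sumr_const card_ord mulr_natl.
have bound : (\int[P]_w (\sum_(k < n) g k w)%:E <=
    (n%:R * A)%:E + (b * (n%:R * r))%:E + (n%:R * c)%:E * \int[P]_w (e w)%:E)%E.
  have nA0 : (0 <= (n%:R * A)%:E)%E by rewrite lee_fin mulr_ge0.
  have nc0 : (0 <= (n%:R * c)%:E)%E by rewrite lee_fin mulr_ge0.
  have bv0 w : setT w -> (0 <= b%:E * (\sum_(k < n) v k w)%:E)%E.
    by move=> _; rewrite mule_ge0// lee_fin.
  have nce0 w : setT w -> (0 <= (n%:R * c)%:E * (e w)%:E)%E.
    by move=> _; rewrite mule_ge0// lee_fin.
  have mbv : measurable_fun setT (fun w => b%:E * (\sum_(k < n) v k w)%:E)%E.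
    exact/measurable_funeM/measurable_EFinP.
  have mnce : measurable_fun setT (fun w => (n%:R * c)%:E * (e w)%:E)%E.
    exact/measurable_funeM/measurable_EFinP.
  apply: (@le_trans _ _ (\int[P]_w ((n%:R * A)%:E + b%:E * (\sum_(k < n) v k w)%:E
      + (n%:R * c)%:E * (e w)%:E))%E).
    apply: ge0_le_integral => //.
    - by move=> w _; rewrite lee_fin sumr_ge0.
    - exact/measurable_EFinP.
    - by apply: emeasurable_funD => //; exact: emeasurable_funD.
    - by move=> w _; rewrite -!EFinM -!EFinD lee_fin.
  rewrite (ge0_integralD P measurableT) => //; first last.
  - by apply: emeasurable_funD.
  - by move=> w _; rewrite adde_ge0// bv0.
  rewrite (ge0_integralD P measurableT)//.
  rewrite (ge0_integralZl P measurableT)//; first last.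
  - by move=> w _; rewrite lee_fin.
  - exact/measurable_EFinP.
  rewrite (ge0_integralZl P measurableT)//; first last.
  - by move=> w _; rewrite lee_fin.
  - exact/measurable_EFinP.
  rewrite integral_cst// [X in (_ * X + _ + _)%E](probability_setT P) mule1.
  by rewrite leeD2r// leeD2l// EFinM lee_wpmul2l// lee_fin.
(* Only the finite factor [n] is cancelled, since the integral of [e] may be infinite. *)
have fn : n%:R%:E \is a @fin_num R by [].
rewrite -(lee_pmul2l fn) ?lte_fin//; apply: (le_trans sum_mu); apply: (le_trans bound).
move: (\int[P]_w (e w)%:E)%E => Ie; rewrite -!EFinD muleDr ?fin_num_adde_defr//.
by rewrite muleA -!EFinM mulrDr (mulrCA b).
Qed.

(** Integer powers of a seventh root replace the real exponents, so that [field] can treat the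
    rates. *)
Lemma powR_sevenths {R : realType} (x : R) (k : nat) :
  0 <= x -> x `^ (k%:R / 7) = (x `^ (1 / 7)) ^+ k.
Proof.
move=> x0; rewrite -powR_mulrn ?powR_ge0// -powRrM; congr (_ `^ _).
by rewrite mul1r mulrC.
Qed.

(** All terms match exactly except the initial error, whose order q^-3 is relaxed to q^-2; the slack
    is the factor [q ^+ 4 * (q - 1)]. *)
Lemma rate_rescaling {R : realFieldType} (q n eh Delta G V e E L0 M0 M1 : R) :
  1 <= q -> n = q ^+ 7 -> 0 < eh -> 0 <= e ->
  eh / q ^+ 5 * G <= 2 * Delta + 4 * (eh / q ^+ 5) * (V + e / (1 / q ^+ 4)
      + n * ((eh / q) ^+ 2 * (M0 / 2 + M1 * L0 * E * eh / 3)))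
    + n * (L0 * E * (eh / q ^+ 5) ^+ 2) ->
  G <= n * (2 * Delta / (eh * q ^+ 2) + eh * L0 * E / q ^+ 5
      + 2 * (M0 + 2 * M1 / 3 * L0 * eh * E) * (eh ^+ 2 / q ^+ 2))
    + 4 * V + n * (4 / q ^+ 2) * e.
Proof.
move=> q1 -> eh0 e0 h; have q0 : 0 < q by exact: lt_le_trans q1.
rewrite -(@ler_pM2l _ (eh / q ^+ 5)) ?divr_gt0 ?exprn_gt0//; apply: (le_trans h).
rewrite -subr_ge0 [leRHS](_ : _ = 4 * (eh / q ^+ 5) * e * (q ^+ 4 * (q - 1))).
  have eq5 : 0 <= eh / q ^+ 5 by rewrite divr_ge0 ?exprn_ge0 ?(ltW q0)// ltW.
  apply: mulr_ge0; first by apply: mulr_ge0 => //; exact: mulr_ge0.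
  by rewrite mulr_ge0 ?exprn_ge0 ?subr_ge0// ltW.
by field; rewrite !gt_eqF.
Qed.

Unset Implicit Arguments.
Set Strict Implicit.

Theorem theorem3 (R : realType) (d : nat) (d_gt0 : (0 < d)%N)
    (N : 'rV[R]_d -> R) (N_norm : is_norm N)
    (rho_lo rho_hi : R) (rho_lo_gt0 : 0 < rho_lo) (rho_hi_gt0 : 0 < rho_hi)
    (rhoP : forall u : 'rV[R]_d,
       rho_lo * norm2 u <= dual_norm N u <= rho_hi * norm2 u)
    (dS dT : measure_display)
    (S : measurableType dS) (D : probability S R)
    (T : measurableType dT) (P : probability T R)
    (F : S -> 'rV[R]_d -> R) (f : 'rV[R]_d -> R)
    (f_mean : is_stochastic_model D F f)
    (f_diff2 : twice_differentiable f)
    (sigma_g sigma_H : R) (sigma_g_ge0 : 0 <= sigma_g)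
    (A1 : unbiased_bounded_variance D F f sigma_g sigma_H)
    (A2 : has_lbound (range f))
    (L0 L1 : R) (L1_gt0 : 0 < L1)
    (A3 : symmetric_lipschitz_grad N f L0 L1)
    (M0 M1 : R) (M1_gt0 : 0 < M1)
    (A4 : symmetric_lipschitz_hess N f M0 M1)
    (K : nat) (K_ge1 : (1 <= K)%N)
    (xi : nat -> {RV P >-> S})
    (m0 : T -> 'rV[R]_d) (m0_meas : measurable_rV m0)
    (xi_law : forall k (A : set S), measurable A ->
       distribution P (xi k.+1) A = D A)
    (xi_indep : mutually_independent P
       (initial_and_sample_events m0 (fun k => xi k : T -> S)))
    (x0 : 'rV[R]_d) (lmo : nat -> 'rV[R]_d -> 'rV[R]_d)
    (x y m : nat -> T -> 'rV[R]_d) :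
  let f_inf : R := inf (range f) in
  let alpha : R := 1 / (K.+1%:R `^ (4 / 7)) in
  let eta_hat : R := Num.min (1 / (3 * L1)) (1 / (3 * Num.sqrt M1)) in
  let eta : R := eta_hat / (K.+1%:R `^ (5 / 7)) in
  (forall k, (k <= K)%N -> is_lmo N eta (lmo k)) ->
  lmo_extrapolated_momentum F (fun k => xi k : T -> S) lmo (fun=> alpha) K
    x0 m0 x y m ->
  (\big[mine/+oo]_(k < K.+1) 'E_P[fun w => dual_norm N (grad f (x k w))]
   <= (2 * (f x0 - f_inf) / (eta_hat * K.+1%:R `^ (2 / 7)))%:E
      + (eta_hat * L0 * expR (L1 * eta_hat) / K.+1%:R `^ (5 / 7))%:E
      + (4 / K.+1%:R `^ (2 / 7))%:E
        * ('E_P[fun w => dual_norm N (m0 w - grad f x0)]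
           + (rho_hi * sigma_g)%:E)
      + (2 * (M0 + 2 * M1 / 3 * L0 * eta_hat * expR (L1 * eta_hat))
         * (eta_hat ^+ 2 / K.+1%:R `^ (2 / 7)))%:E)%E.
Proof.
move=> f_inf alpha eta_hat eta lmoP method.
have [F_diff2 _] := f_mean.
have [grad_mean grad_var _ _] := A1.
pose n : R := K.+1%:R; pose q : R := n `^ (1 / 7).
have n0 : 0 <= n by [].
have q7 : q ^+ 7 = n by rewrite /q -powR_sevenths// divff// powRr1.
have q1 : 1 <= q by rewrite -(@expr_ge1 _ 7) ?powR_ge0// q7 /n ler1n.
have q0 : 0 < q by exact: lt_le_trans q1.
have alphaE : alpha = 1 / q ^+ 4 by rewrite /alpha (powR_sevenths 4).
have etaE : eta = eta_hat / q ^+ 5 by rewrite /eta (powR_sevenths 5).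
have sM : 0 < Num.sqrt M1 by rewrite sqrtr_gt0.
have eh0 : 0 < eta_hat by rewrite lt_min !divr_gt0// mulr_gt0.
have L1eh : L1 * eta_hat <= 1 / 3.
  have : eta_hat <= 1 / (3 * L1) by rewrite ge_min lexx.
  by rewrite ler_pdivlMr ?mulr_gt0//; lra.
have M1eh : M1 * eta_hat ^+ 2 <= 1 / 9.
  have : eta_hat <= 1 / (3 * Num.sqrt M1) by rewrite ge_min lexx orbT.
  rewrite ler_pdivlMr ?mulr_gt0// => h.
  have : (eta_hat * (3 * Num.sqrt M1)) ^+ 2 <= 1.
    by rewrite expr_le1// mulr_ge0 ?mulr_ge0// ltW.
  by rewrite !exprMn (sqr_sqrtr (ltW M1_gt0)); lra.
have al0 : 0 < alpha by rewrite alphaE divr_gt0// exprn_gt0.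
have al1 : alpha <= 1 by rewrite alphaE ler_pdivrMr ?exprn_gt0// mul1r exprn_ege1.
have eta0 : 0 < eta by rewrite etaE divr_gt0// exprn_gt0.
have eta_eh : eta <= eta_hat.
  by rewrite etaE ler_pdivrMr ?exprn_gt0// ler_peMr ?exprn_ege1// ltW.
have etaalE : eta / alpha = eta_hat / q by rewrite etaE alphaE; field; rewrite gt_eqF.
have etaal_eh : eta / alpha <= eta_hat by rewrite etaalE ler_pdivrMr// ler_peMr// ltW.
have L00 := grad_lipschitz_const_ge0 d_gt0 N_norm rho_lo_gt0 rho_hi_gt0 rhoP f_diff2
  L1_gt0 A3 A2.
have M00 := hess_lipschitz_const_ge0 d_gt0 N_norm rho_lo_gt0 rho_hi_gt0 rhoP f_diff2
  L1_gt0 A3 A2 M1_gt0 A4.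
have lmo_meas k : (k <= K)%N -> measurable_rV (lmo k : borel_rV R d -> 'rV[R]_d).
  by move=> /lmoP[].
have [x0E m0E stepE] := method.
have dual0 u : 0 <= dual_norm N u by exact: (dual_norm_ge0 N_norm rho_lo_gt0 rhoP).
have dualc := dual_norm_continuous N_norm rho_lo_gt0 rhoP rho_hi_gt0.
have meas k (kK : (k <= K)%N) := measurable_iterates F_diff2 f_diff2 grad_mean lmo_meas method
  (phi := idfun) (leqW kK) m0_meas (fun j _ => measurable_funP (xi j.+1)).
set E := expR (L1 * eta_hat).
have E0 : 0 <= E by exact: expR_ge0.
set Ainit := 2 * (f x0 - f_inf) / _.
set Aquad := eta_hat * L0 * E / _.
set Ahess := 2 * (M0 + _) * _.
have q2 : n `^ (2 / 7) = q ^+ 2 by rewrite (powR_sevenths 2).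
have q5 : n `^ (5 / 7) = q ^+ 5 by rewrite (powR_sevenths 5).
pose V k w := noise_average alpha (sample_noise (F := F) (f := f) (xi := xi) (y := y) w) k.
(* The last argument is [rho_hi * sigma_g] times the square root of [alpha], which is [q^-2]. *)
have main := @bigmine_le_average R _ T P K.+1
  (fun k w => dual_norm N (grad f (x k w)))
  (fun k w => dual_norm N (V k w))
  (fun w => dual_norm N (m0 w - grad f x0))
  (Ainit + Aquad + Ahess) 4 (4 / n `^ (2 / 7)) (rho_hi * (sigma_g / q ^+ 2)).
rewrite expectation.unlock.
apply: (le_trans (main _ _ _ _ _ _ _ _ _ _ _ _)) => //.
(* The constant term has to be nonnegative, which depends on the signs of [L0] and [M0]. *)
- have fx0 : 0 <= f x0 - f_inf by rewrite subr_ge0; apply: ge_inf => //; exists x0.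
  have eh := ltW eh0; have M1_ge0 := ltW M1_gt0.
  apply: addr_ge0; first apply: addr_ge0.
  + by apply: divr_ge0; [exact: mulr_ge0|rewrite mulr_ge0 ?powR_ge0].
  + by rewrite divr_ge0 ?powR_ge0// !mulr_ge0.
  + apply: mulr_ge0; last by rewrite divr_ge0 ?powR_ge0 ?sqr_ge0.
    by apply: mulr_ge0 => //; apply: addr_ge0 => //; rewrite !mulr_ge0.
- by rewrite divr_ge0// powR_ge0.
- move=> k kK; have [mx _ _] := meas k kK.
  exact: measurable_comp_continuous dualc (measurable_grad f_diff2 mx).
- move=> k kK; have [_ _ mV] := meas k kK.
  exact: measurable_comp_continuous dualc mV.
- have mcst : measurable_rV (fun _ : T => grad f x0).
    by apply/measurable_rVP => i; exact: measurable_cst.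
  exact: measurable_comp_continuous dualc (measurable_rVB m0_meas mcst).
- move=> k kK; have [_ _ mV] := meas k kK.
  have c0 : 0 <= rho_hi * (sigma_g / q ^+ 2).
    by rewrite mulr_ge0 ?divr_ge0 ?exprn_ge0// ltW.
  apply: integral_le_of_sqr => //; first exact: measurable_comp_continuous dualc mV.
  have mdot : measurable_fun setT (fun w =>
      (dot (V k w) (V k w))%:E).
    by apply/measurable_EFinP; exact: (measurable_dot mV mV).
  have rho2 : (0 <= (rho_hi ^+ 2)%:E)%E by rewrite lee_fin sqr_ge0.
  apply: (@le_trans _ _ (\int[P]_w ((rho_hi ^+ 2)%:E * (dot
      (V k w) (V k w))%:E))%E).
    apply: ge0_le_integral => //.
    + by move=> w _; rewrite lee_fin sqr_ge0.
    + apply/measurable_EFinP/measurable_funX; exact: measurable_comp_continuous dualc mV.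
    + exact: measurable_funeM.
    + move=> w _; rewrite lee_fin -sqr_norm2 -exprMn.
      apply: lerXn2r; rewrite ?nnegrE ?mulr_ge0 ?norm2_ge0 ?(ltW rho_hi_gt0)//.
      by have /andP[] := rhoP (V k w).
  rewrite (ge0_integralZl P measurableT)//; last by move=> w _; rewrite lee_fin dotxx_ge0.
  have V2 := second_moment_noise F_diff2 f_diff2 grad_mean grad_var (ltW al0) al1
    m0_meas xi_law xi_indep lmo_meas method kK.
  apply: (le_trans (lee_wpmul2l rho2 V2)).
  rewrite -EFinM lee_fin le_eqVlt; apply/orP; left; apply/eqP.
  by rewrite alphaE; field; rewrite gt_eqF.
- move=> w; rewrite q2.
  have h := trajectory_bound d_gt0 N_norm rho_lo_gt0 rho_hi_gt0 rhoP f_diff2 A2 L1_gt0 A3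
    M1_gt0 A4 al0 al1 eta0 eta_eh etaal_eh L1eh M1eh (K := K)
    (x := fun k => x k w) (y := fun k => y k w) (m := fun k => m k w)
    (g := fun k => grad (F (xi k w)) (y k w)) (lmo := lmo).
  have {}h := h (fun k kK => ((lmoP k kK).2 (m k w)).1)
    (fun k v kK => ((lmoP k kK).2 (m k w)).2 v).
  have {}h := h (fun k kK => let: And3 e _ _ := stepE k w kK in e)
    (fun k kK => let: And3 _ e _ := stepE k w kK in e)
    (fun k kK => let: And3 _ _ e := stepE k w kK in e).
  rewrite /Ainit /Aquad /Ahess q2 q5.
  rewrite x0E m0E in h.
  apply: (rate_rescaling q1 (esym q7) eh0 (dual0 _)).
  by rewrite -etaE -alphaE -etaalE.
move: (\int[P]_w _)%E => Ie.
rewrite q2 muleDr ?fin_num_adde_defl// -EFinM.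
have -> : 4 * (rho_hi * (sigma_g / q ^+ 2)) = 4 / q ^+ 2 * (rho_hi * sigma_g).
  by field; rewrite gt_eqF.
(* The expected initial error may be infinite, hence the case analysis on an extended real. *)
move: (_%:E * Ie)%E (4 / q ^+ 2 * (rho_hi * sigma_g)) => [J| |] r //.
by rewrite -!EFinD lee_fin; lra.
Qed.
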